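(* Let $x,y:\mathcal{D}\to\mathbb{C}$ be holomorphic on the open unit disc, and for $i,j\ge1$ put $\sigma_{ij}=x^{(i)}y^{(j)}-x^{(j)}y^{(i)}$. Assume $\sigma_{12}(z)\neq0$ for all $z\in\mathcal{D}$. Then the Schwarzian curvatures $\kappa_0,\kappa_1$ of the curve $\Phi:\mathcal{D}\to\mathbb{CP}^2$, $\Phi(z)=[1:x(z):y(z)]$, are $$\kappa_0=-\frac{16}{27}\left(\frac{\sigma_{13}}{\sigma_{12}}\right)^3+\frac13\,\frac{\sigma_{13}(3\sigma_{14}+2\sigma_{23})}{\sigma_{12}^2}-\frac13\,\frac{\sigma_{15}+2\sigma_{24}}{\sigma_{12}},$$ $$\kappa_1=\frac43\left(\frac{\sigma_{13}}{\sigma_{12}}\right)^2-\frac{\sigma_{14}+2\sigma_{23}}{\sigma_{12}}.$$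
   Context: For a curve $\Phi:\mathcal{D}\to\mathbb{CP}^2$ with holomorphic lifting $f:\mathcal{D}\to\mathbb{C}^3\setminus\{0\}$ (here $f=(1,x,y)$) such that $f,f',f''$ are pointwise linearly independent, choose a holomorphic $\lambda:\mathcal{D}\to\mathbb{C}\setminus\{0\}$ with $\lambda^3\det[f,f',f'']=1$ and put $\nu=\lambda f$, so that $\det[\nu,\nu',\nu'']=1$. Then $\det[\nu,\nu',\nu''']=0$, so there are unique holomorphic functions $\kappa_0,\kappa_1$ on $\mathcal{D}$ with $\nu'''=\kappa_0\nu+\kappa_1\nu'$; these are the Schwarzian curvatures of $\Phi$ (they do not depend on the choice of $f$ and $\lambda$). *)

(* Defs.v *)
From Stdlib Require Import Reals Lra.
From Coquelicot Require Import Coquelicot.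

Open Scope C_scope.

Definition unit_disc (z : C) : Prop := (Cmod z < 1)%R.

(* Functions on the disc are total functions on [C] of which only the values on
   the disc matter.  Holomorphic means complex differentiable at every point of
   the disc: derivatives are taken over the field [C], not over [R]. *)
Definition holomorphic {V : NormedModule C_AbsRing} (f : C -> V) : Prop :=
  forall z : C, unit_disc z -> ex_derive f z.

(* [C_derive f z] is the complex derivative at every point where [f] is complex
   differentiable ([C_derive_correct]) and a junk value elsewhere. *)
Fixpoint C_derive_n (f : C -> C) (n : nat) : C -> C :=
  match n with
  | O => f
  | S n => C_derive (C_derive_n f n)
  end.

(* C^3; its elements are written [(a, b, c)]. *)
Definition C3 : NormedModule C_AbsRing :=
  prod_NormedModule C_AbsRing
    (prod_NormedModule C_AbsRing C_NormedModule C_NormedModule) C_NormedModule.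

Definition vec3 (a b c : C) : C3 := (a, b, c).

Definition C3_derive_n (f : C -> C3) (n : nat) (z : C) : C3 :=
  vec3 (C_derive_n (fun w => fst (fst (f w))) n z)
       (C_derive_n (fun w => snd (fst (f w))) n z)
       (C_derive_n (fun w => snd (f w)) n z).

Definition det3 (u v w : C3) : C :=
  let '(u1, u2, u3) := u in
  let '(v1, v2, v3) := v in
  let '(w1, w2, w3) := w in
  u1 * (v2 * w3 - v3 * w2) - u2 * (v1 * w3 - v3 * w1) + u3 * (v1 * w2 - v2 * w1).

Definition lin_indep3 (u v w : C3) : Prop :=
  forall a b c : C,
    plus (plus (scal a u) (scal b v)) (scal c w) = zero ->
    a = 0 /\ b = 0 /\ c = 0.

(* A point of CP^2 is an equivalence class of nonzero vectors of C^3 for the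
   relation of being nonzero multiples of each other. *)
Definition proportional (v w : C3) : Prop :=
  exists c : C, c <> 0 /\ w = scal c v.

Record CP2 : Type := MkCP2 {
  represents : C3 -> Prop;
  CP2_class : exists v : C3,
      v <> zero /\ forall w : C3, represents w <-> proportional v w
}.

(* The class [v] of a nonzero vector [v]. *)
Definition CP2_point (v : C3) (hv : v <> zero) : CP2 :=
  MkCP2 (proportional v)
        (ex_intro _ v (conj hv (fun w => iff_refl (proportional v w)))).

Lemma vec3_1_neq0 (a b : C) : vec3 1 a b <> zero.
Proof.
  intros H.
  assert (H1 : fst (fst (fst (vec3 1 a b))) = 0%R) by (rewrite H; reflexivity).
  simpl in H1; lra.
Qed.

(* The curve z |-> [1 : x(z) : y(z)]. *)
Definition affine_curve (x y : C -> C) (z : C) : CP2 :=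
  CP2_point (vec3 1 (x z) (y z)) (vec3_1_neq0 (x z) (y z)).

(* Since every representative of a point of CP^2 is nonzero, a lifting takes
   its values on the disc in C^3 \ {0}. *)
Definition holomorphic_lifting (Phi : C -> CP2) (f : C -> C3) : Prop :=
  holomorphic f /\ forall z : C, unit_disc z -> represents (Phi z) (f z).

(* [lam] and [f] are existentially quantified: the curvatures do not depend on
   which normalized lifting [nu = lam f] is chosen. *)
Definition schwarzian_curvatures (Phi : C -> CP2) (k0 k1 : C -> C) : Prop :=
  holomorphic k0 /\ holomorphic k1 /\
  exists (f : C -> C3) (lam : C -> C),
    holomorphic_lifting Phi f /\
    (forall z : C, unit_disc z ->
       lin_indep3 (f z) (C3_derive_n f 1 z) (C3_derive_n f 2 z)) /\
    holomorphic lam /\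
    (forall z : C, unit_disc z -> lam z <> 0) /\
    (forall z : C, unit_disc z ->
       lam z ^ 3 * det3 (f z) (C3_derive_n f 1 z) (C3_derive_n f 2 z) = 1) /\
    let nu : C -> C3 := fun z => scal (lam z) (f z) in
    forall z : C, unit_disc z ->
      C3_derive_n nu 3 z =
        plus (scal (k0 z) (nu z)) (scal (k1 z) (C3_derive_n nu 1 z)).

Definition sigma_ij (x y : C -> C) (i j : nat) (z : C) : C :=
  C_derive_n x i z * C_derive_n y j z - C_derive_n x j z * C_derive_n y i z.

(* Main.v *)
(** A normalized lifting is nu = mu (1, x, y) with mu^3 sigma_12 = 1.
    Differentiating this relation three times gives mu', mu'', mu''' as
    multiples of mu with coefficients in the sigma_ij, and the coordinates of
    nu''' = kappa_0 nu + kappa_1 nu' are then linear equations for the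
    curvatures.  Two facts of complex analysis are needed: a holomorphic
    function is infinitely differentiable, and sigma_12 has a holomorphic
    logarithm, hence an inverse cube root, on the disc.

    Goursat's argument on triangles gives every holomorphic f a primitive F.
    Set B(h) = int_0^{2pi} F(w + h e^{it}) e^{-it} dt.  Then
    B'(h) = int_0^{2pi} f(w + h e^{it}) dt, while integration by parts gives
    h B'(h) = B(h).  So B' is constant on rays, equal to 2 pi f(w), and
    f(w) = (2 pi r)^{-1} int_0^{2pi} F(w + r e^{it}) e^{-it} dt.
    Differentiating under the integral shows that f' is continuous; the same
    formula for the pair (f, f') then shows that f' is holomorphic. *)

Require Import Defs.
From Stdlib Require Import Reals Lra Lia Psatz Classical ClassicalEpsilon.
From Coquelicot Require Import Coquelicot.

Open Scope C_scope.

(** * Complex differentiation *)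

(** The lifting is existentially quantified in the definition of the curvatures, so one implication
    must cope with an arbitrary [f] and [lam], while the other must exhibit a pair. Both reduce to
    one scalar: if [c] is the first coordinate of [f], then [lam f] is [mu (1, x, y)] with
    [mu = lam c], and the determinant condition becomes [mu^3 sigma_12 = 1]. Only this equation is
    used about [mu]. It fixes the quotients of the derivatives of [mu] by [mu] without reference to
    a choice of cube root, which is why all liftings lead to the same curvatures. A cube root has to
    be constructed only for the converse, where the curvatures must also be shown to be holomorphic.

    The integral formula expresses [f] by its primitive [F], not by [f] itself, because [w] then
    enters only as a translation of the circle. There is no singular kernel to differentiate, and
    differentiation under the integral asks only for the continuity of [f]. This breaks the circle
    in which smoothness of [f'] would be needed in order to prove smoothness of [f']. *)

Definition Cderiv (f : C -> C) (z l : C) : Prop :=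
  forall eps : R, (0 < eps)%R -> exists delta : R, (0 < delta)%R /\
    forall h : C, (Cmod h < delta)%R ->
      (Cmod (f (z + h)%C - f z - l * h) <= eps * Cmod h)%R.

Definition Ccont (f : C -> C) (z : C) : Prop :=
  forall eps : R, (0 < eps)%R -> exists delta : R, (0 < delta)%R /\
    forall h : C, (Cmod h < delta)%R -> (Cmod (f (z + h)%C - f z) < eps)%R.

Definition path_deriv (g : R -> C) (t : R) (l : C) : Prop :=
  forall eps : R, (0 < eps)%R -> exists delta : R, (0 < delta)%R /\
    forall h : R, (Rabs h < delta)%R ->
      (Cmod (g (t + h)%R - g t - l * h) <= eps * Rabs h)%R.

Definition path_cont (g : R -> C) (t : R) : Prop :=
  forall eps : R, (0 < eps)%R -> exists delta : R, (0 < delta)%R /\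
    forall h : R, (Rabs h < delta)%R -> (Cmod (g (t + h)%R - g t) < eps)%R.

Lemma Cplus_minus_l (z h : C) : z + h - z = h.
Proof. ring. Qed.

Lemma Cplus_minus (z w : C) : z + (w - z) = w.
Proof. ring. Qed.

(** The increment form allows [h = 0] and contains no quotient, which suits explicit estimates; this
    equivalence gives access to the library rules for sums and constants. *)
Lemma is_derive_Cderiv (f : C -> C) (z l : C) :
  is_derive (K := C_AbsRing) (V := C_NormedModule) f z l <-> Cderiv f z l.
Proof.
split.
- intros [_ H] eps Heps.
  specialize (H z (fun P HP => HP) (mkposreal eps Heps)).
  destruct H as [d Hd].
  exists (pos d); split; [apply cond_pos|].
  intros h Hh.
  specialize (Hd (z + h)).
  assert (Hb : @ball (AbsRing_UniformSpace C_AbsRing) z d (z + h)).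
  { change (Cmod (z + h - z) < d)%R. rewrite Cplus_minus_l. exact Hh. }
  specialize (Hd Hb).
  change (Cmod (f (z + h)%C - f z - (z + h - z) * l) <= eps * Cmod (z + h - z))%R in Hd.
  rewrite Cplus_minus_l in Hd.
  rewrite (Cmult_comm l h). exact Hd.
- intros H. split.
  + apply is_linear_scal_l.
  + intros z0 Hz0 eps.
    apply (@is_filter_lim_locally_unique _ (AbsRing_NormedModule C_AbsRing)) in Hz0; subst z0.
    destruct (H eps (cond_pos eps)) as [d [Hd Hh]].
    exists (mkposreal d Hd). intros y Hy.
    change (Cmod (y - z) < d)%R in Hy.
    specialize (Hh (y - z) Hy).
    change (Cmod (f y - f z - (y - z) * l) <= eps * Cmod (y - z))%R.
    rewrite Cplus_minus in Hh.
    rewrite (Cmult_comm (y - z) l). exact Hh.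
Qed.

(** [C] carries two normed module structures over itself that are not syntactically the same. The
    library states the rules for products, the identity and inner functions over the ring's own
    module, hence a second bridge. *)
Lemma is_derive_Cderiv_ring (f : C -> C) (z l : C) :
  is_derive (K := C_AbsRing) (V := AbsRing_NormedModule C_AbsRing) f z l <-> Cderiv f z l.
Proof.
split.
- intros [_ H] eps Heps.
  specialize (H z (fun P HP => HP) (mkposreal eps Heps)).
  destruct H as [d Hd].
  exists (pos d); split; [apply cond_pos|].
  intros h Hh.
  specialize (Hd (z + h)).
  assert (Hb : @ball (AbsRing_UniformSpace C_AbsRing) z d (z + h)).
  { change (Cmod (z + h - z) < d)%R. rewrite Cplus_minus_l. exact Hh. }
  specialize (Hd Hb).
  change (Cmod (f (z + h)%C - f z - (z + h - z) * l) <= eps * Cmod (z + h - z))%R in Hd.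
  rewrite Cplus_minus_l in Hd.
  rewrite (Cmult_comm l h). exact Hd.
- intros H. split.
  + apply is_linear_scal_l.
  + intros z0 Hz0 eps.
    apply (@is_filter_lim_locally_unique _ (AbsRing_NormedModule C_AbsRing)) in Hz0; subst z0.
    destruct (H eps (cond_pos eps)) as [d [Hd Hh]].
    exists (mkposreal d Hd). intros y Hy.
    change (Cmod (y - z) < d)%R in Hy.
    specialize (Hh (y - z) Hy).
    change (Cmod (f y - f z - (y - z) * l) <= eps * Cmod (y - z))%R.
    rewrite Cplus_minus in Hh.
    rewrite (Cmult_comm (y - z) l). exact Hh.
Qed.

Lemma Cmod_minus_sym (a b : C) : Cmod (a - b) = Cmod (b - a).
Proof. rewrite <- Cmod_opp. f_equal; ring. Qed.

Lemma Cmod_triangle_minus (a b : C) : (Cmod (a - b) <= Cmod a + Cmod b)%R.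
Proof. rewrite <- (Cmod_opp b). apply Cmod_triangle. Qed.

Lemma Cmod_triangle_inv (a b : C) : (Cmod a <= Cmod b + Cmod (a - b))%R.
Proof. replace a with (b + (a - b)) at 1 by ring. apply Cmod_triangle. Qed.

Lemma Cderiv_eq (f : C -> C) (z l l' : C) : Cderiv f z l -> l = l' -> Cderiv f z l'.
Proof. now intros H <-. Qed.

Lemma Cderiv_C_derive (f : C -> C) (z l : C) : Cderiv f z l -> C_derive f z = l.
Proof. intros H. apply is_C_derive_unique. now apply is_derive_Cderiv. Qed.

Lemma holomorphic_Cderiv (f : C -> C) (z : C) :
  ex_derive (K := C_AbsRing) (V := C_NormedModule) f z -> Cderiv f z (C_derive f z).
Proof. intros H. apply is_derive_Cderiv. now apply (C_derive_correct f z z). Qed.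

Lemma Cderiv_ex_derive (f : C -> C) (z l : C) :
  Cderiv f z l -> ex_derive (K := C_AbsRing) (V := C_NormedModule) f z.
Proof. intros H. exists l. now apply is_derive_Cderiv. Qed.

Lemma Cderiv_const (c z : C) : Cderiv (fun _ => c) z 0.
Proof. apply is_derive_Cderiv, (is_derive_const (K := C_AbsRing) (V := C_NormedModule)). Qed.

Lemma Cderiv_id (z : C) : Cderiv (fun w => w) z 1.
Proof. apply is_derive_Cderiv_ring, (is_derive_id (K := C_AbsRing)). Qed.

Lemma Cderiv_plus (f g : C -> C) (z a b : C) :
  Cderiv f z a -> Cderiv g z b -> Cderiv (fun w => f w + g w) z (a + b).
Proof.
rewrite <- !is_derive_Cderiv. intros Hf Hg.
exact (is_derive_plus (K := C_AbsRing) (V := C_NormedModule) f g z a b Hf Hg).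
Qed.

Lemma Cderiv_minus (f g : C -> C) (z a b : C) :
  Cderiv f z a -> Cderiv g z b -> Cderiv (fun w => f w - g w) z (a - b).
Proof.
rewrite <- !is_derive_Cderiv. intros Hf Hg.
exact (is_derive_minus (K := C_AbsRing) (V := C_NormedModule) f g z a b Hf Hg).
Qed.

Lemma Cderiv_mult (f g : C -> C) (z a b : C) :
  Cderiv f z a -> Cderiv g z b -> Cderiv (fun w => f w * g w) z (a * g z + f z * b).
Proof.
rewrite <- !is_derive_Cderiv_ring. intros Hf Hg.
exact (is_derive_mult (K := C_AbsRing) f g z a b Hf Hg Cmult_comm).
Qed.

Lemma Cderiv_comp (f g : C -> C) (z a b : C) :
  Cderiv f (g z) a -> Cderiv g z b -> Cderiv (fun w => f (g w)) z (b * a).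
Proof.
intros Hf Hg. apply is_derive_Cderiv in Hf. apply is_derive_Cderiv_ring in Hg. apply is_derive_Cderiv.
exact (is_derive_comp (K := C_AbsRing) (V := C_NormedModule) f g z a b Hf Hg).
Qed.

Lemma Cderiv_ext_loc (f g : C -> C) (z l : C) (d : R) : (0 < d)%R ->
  (forall h, (Cmod h < d)%R -> f (z + h)%C = g (z + h)%C) -> Cderiv f z l -> Cderiv g z l.
Proof.
intros Hd Heq H eps Heps. destruct (H eps Heps) as [d' [Hd' H']].
exists (Rmin d d'); split; [now apply Rmin_glb_lt|].
intros h Hh.
rewrite <- Heq by (eapply Rlt_le_trans; [exact Hh|apply Rmin_l]).
assert (E : g z = f z).
{ replace z with (z + 0) by ring. rewrite Heq; [easy|]. now rewrite Cmod_0. }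
rewrite E. apply H'. eapply Rlt_le_trans; [exact Hh|apply Rmin_r].
Qed.

Lemma Cderiv_Ccont (f : C -> C) (z l : C) : Cderiv f z l -> Ccont f z.
Proof.
intros H eps Heps. destruct (H 1%R Rlt_0_1) as [d [Hd Hh]].
assert (Hl := Cmod_ge_0 l).
assert (Hp : (0 < eps / (2 + Cmod l))%R) by (apply Rdiv_lt_0_compat; lra).
exists (Rmin d (eps / (2 + Cmod l))); split; [now apply Rmin_glb_lt|].
intros h H1.
assert (H2 : (Cmod h < d)%R) by (eapply Rlt_le_trans; [exact H1|apply Rmin_l]).
assert (H3 : (Cmod h < eps / (2 + Cmod l))%R) by (eapply Rlt_le_trans; [exact H1|apply Rmin_r]).
specialize (Hh h H2).
replace (f (z + h)%C - f z) with ((f (z + h)%C - f z - l * h) + l * h) by ring.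
eapply Rle_lt_trans; [apply Cmod_triangle|]. rewrite Cmod_mult.
apply Rle_lt_trans with ((1 + Cmod l) * Cmod h)%R; [lra|].
assert (H4 : ((2 + Cmod l) * Cmod h < eps)%R).
{ apply (Rmult_lt_compat_l (2 + Cmod l)) in H3; [|lra].
  replace ((2 + Cmod l) * (eps / (2 + Cmod l)))%R with eps in H3 by (field; lra). exact H3. }
assert (H5 := Cmod_ge_0 h). nra.
Qed.

Lemma Cderiv_inv (z : C) : z <> 0 -> Cderiv Cinv z (- / (z * z)).
Proof.
intros Hz eps Heps. assert (Hm := proj1 (Cmod_gt_0 z) Hz).
set (m := Cmod z) in *.
(* The first bound keeps [|z + h|] above [m / 2]; the second then makes the remainder
   [h^2 / (z^2 (z + h))] at most [eps |h|]. *)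
exists (Rmin (m / 2) (eps * m ^ 3 / 2))%R; split.
{ apply Rmin_glb_lt; [lra|]. apply Rdiv_lt_0_compat; [|lra].
  apply Rmult_lt_0_compat; [easy|]. now apply pow_lt. }
intros h H1.
assert (H2 : (Cmod h < m / 2)%R) by (eapply Rlt_le_trans; [exact H1|apply Rmin_l]).
assert (H3 : (Cmod h < eps * m ^ 3 / 2)%R) by (eapply Rlt_le_trans; [exact H1|apply Rmin_r]).
assert (H4 : (m / 2 < Cmod (z + h))%R).
{ assert (H4 := Cmod_triangle_minus (z + h) h).
  replace (z + h - h) with z in H4 by ring. fold m in H4. lra. }
assert (Hn : z + h <> 0) by (apply Cmod_gt_0; lra).
replace (/ (z + h) - / z - - / (z * z) * h) with (h * (h / (z * z * (z + h))))
  by (field; auto).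
rewrite Cmod_mult, Cmod_div by (repeat apply Cmult_neq_0; auto).
rewrite !Cmod_mult. fold m. rewrite Rmult_comm.
apply Rmult_le_compat_r; [apply Cmod_ge_0|].
assert (H5 : (0 < m * m)%R) by nra.
apply Rle_div_l; [nra|].
assert (H6 : (eps * (m * m) * (m / 2) <= eps * (m * m) * Cmod (z + h))%R)
  by (apply Rmult_le_compat_l; nra).
lra.
Qed.

Lemma path_cont_mult (f g : R -> C) (t : R) :
  path_cont f t -> path_cont g t -> path_cont (fun s => f s * g s) t.
Proof.
intros Hf Hg eps Heps.
set (A := (1 + Cmod (f t) + Cmod (g t))%R).
assert (Ha := Cmod_ge_0 (f t)). assert (Hb := Cmod_ge_0 (g t)).
assert (HA : (1 <= A)%R) by (unfold A; lra).
set (e := Rmin 1 (eps / (2 * A))).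
assert (He : (0 < e)%R).
{ apply Rmin_glb_lt; [lra|]. apply Rdiv_lt_0_compat; lra. }
assert (HeA : (2 * A * e <= eps)%R).
{ assert (H : (e <= eps / (2 * A))%R) by apply Rmin_r.
  apply (Rmult_le_compat_l (2 * A)) in H; [|lra].
  replace (2 * A * (eps / (2 * A)))%R with eps in H by (field; lra). exact H. }
destruct (Hf e He) as [d1 [Hd1 H1]]. destruct (Hg e He) as [d2 [Hd2 H2]].
exists (Rmin d1 d2); split; [now apply Rmin_glb_lt|]. intros h Hh.
specialize (H1 h (Rlt_le_trans _ _ _ Hh (Rmin_l _ _))).
specialize (H2 h (Rlt_le_trans _ _ _ Hh (Rmin_r _ _))).
replace (f (t + h)%R * g (t + h)%R - f t * g t) with
  ((f (t + h)%R - f t) * (g (t + h)%R - g t) +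
   ((f (t + h)%R - f t) * g t + f t * (g (t + h)%R - g t))) by ring.
eapply Rle_lt_trans; [apply Cmod_triangle|].
eapply Rle_lt_trans; [apply Rplus_le_compat_l, Cmod_triangle|].
rewrite !Cmod_mult.
assert (H3 := Cmod_ge_0 (f (t + h)%R - f t)). assert (H4 := Cmod_ge_0 (g (t + h)%R - g t)).
assert (H5 : (e <= 1)%R) by apply Rmin_l.
set (u := Cmod (f (t + h)%R - f t)) in *. set (v := Cmod (g (t + h)%R - g t)) in *.
assert (u * v <= e)%R by nra.
assert (u * Cmod (g t) <= e * Cmod (g t))%R by nra.
assert (Cmod (f t) * v <= e * Cmod (f t))%R by nra.
unfold A in HeA. nra.
Qed.

Lemma path_cont_comp (f : C -> C) (g : R -> C) (t : R) :
  Ccont f (g t) -> path_cont g t -> path_cont (fun s => f (g s)) t.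
Proof.
intros Hf Hg eps Heps.
destruct (Hf eps Heps) as [d [Hd H]]. destruct (Hg d Hd) as [d' [Hd' H']].
exists d'; split; [easy|]. intros h Hh.
replace (g (t + h)%R) with (g t + (g (t + h)%R - g t)) by ring.
now apply H, H'.
Qed.

Lemma path_deriv_cont (g : R -> C) (t : R) (l : C) : path_deriv g t l -> path_cont g t.
Proof.
intros H eps Heps. destruct (H 1%R Rlt_0_1) as [d [Hd Hh]].
assert (Hl := Cmod_ge_0 l).
assert (Hp : (0 < eps / (2 + Cmod l))%R) by (apply Rdiv_lt_0_compat; lra).
exists (Rmin d (eps / (2 + Cmod l))); split; [now apply Rmin_glb_lt|].
intros h H1.
assert (H2 : (Rabs h < d)%R) by (eapply Rlt_le_trans; [exact H1|apply Rmin_l]).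
assert (H3 : (Rabs h < eps / (2 + Cmod l))%R) by (eapply Rlt_le_trans; [exact H1|apply Rmin_r]).
specialize (Hh h H2).
replace (g (t + h)%R - g t) with ((g (t + h)%R - g t - l * h) + l * h) by ring.
eapply Rle_lt_trans; [apply Cmod_triangle|]. rewrite Cmod_mult, Cmod_R.
apply Rle_lt_trans with ((1 + Cmod l) * Rabs h)%R; [lra|].
assert (H4 : ((2 + Cmod l) * Rabs h < eps)%R).
{ apply (Rmult_lt_compat_l (2 + Cmod l)) in H3; [|lra].
  replace ((2 + Cmod l) * (eps / (2 + Cmod l)))%R with eps in H3 by (field; lra). exact H3. }
assert (H5 := Rabs_pos h). nra.
Qed.

(** * Integrals of complex-valued functions of a real variable *)

Lemma Cmod_pair_le (a b : R) : (Cmod (a, b) <= Rabs a + Rabs b)%R.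
Proof.
replace (a, b) with (RtoC a + RtoC b * Ci)
  by (unfold RtoC, Ci, Cplus, Cmult; simpl; f_equal; ring).
eapply Rle_trans; [apply Cmod_triangle|].
rewrite Cmod_mult, Cmod_Ci, !Cmod_R. lra.
Qed.

Lemma norm_C_R (z : C) : norm (V := C_R_NormedModule) z = Cmod z.
Proof.
change (sqrt (Rabs (fst z) ^ 2 + Rabs (snd z) ^ 2) = sqrt (fst z ^ 2 + snd z ^ 2)).
now rewrite !pow2_abs.
Qed.

Lemma path_cont_continuous (g : R -> C) (t : R) :
  path_cont g t -> continuous (U := C_R_NormedModule) g t.
Proof.
intros H. apply filterlim_locally. intros eps.
destruct (H eps (cond_pos eps)) as [d [Hd Hh]].
exists (mkposreal d Hd). intros y Hy.
change (Rabs (y - t) < d)%R in Hy. specialize (Hh _ Hy).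
rewrite Rplus_minus in Hh.
now apply C_NormedModule_mixin_compat1.
Qed.

Lemma path_deriv_is_derive (g : R -> C) (t : R) (l : C) :
  path_deriv g t l -> is_derive (K := R_AbsRing) (V := C_R_NormedModule) g t l.
Proof.
intros H. split.
- apply is_linear_scal_l.
- intros s Hs eps.
  apply (@is_filter_lim_locally_unique _ (AbsRing_NormedModule R_AbsRing)) in Hs; subst s.
  destruct (H eps (cond_pos eps)) as [d [Hd Hh]].
  exists (mkposreal d Hd). intros y Hy.
  change (Rabs (y - t) < d)%R in Hy. specialize (Hh _ Hy).
  rewrite Rplus_minus in Hh.
  rewrite norm_C_R.
  change (Cmod (g y - g t - scal (V := C_R_ModuleSpace) (y - t)%R l) <= eps * Rabs (y - t))%R.
  rewrite scal_R_Cmult, (Cmult_comm _ l). exact Hh.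
Qed.

Lemma path_deriv_pair (f g : R -> R) (t a b : R) :
  is_derive f t a -> is_derive g t b -> path_deriv (fun s => (f s, g s)) t (a, b).
Proof.
intros Hf Hg eps Heps.
apply is_derive_Reals in Hf. apply is_derive_Reals in Hg.
assert (He2 : (0 < eps / 2)%R) by lra.
destruct (Hf _ He2) as [d1 H1]. destruct (Hg _ He2) as [d2 H2].
exists (Rmin d1 d2); split; [apply Rmin_glb_lt; apply cond_pos|]. intros h Hh.
assert (Haux : forall (k : R -> R) (c : R) (d : posreal),
  (forall u : R, u <> 0%R -> (Rabs u < d)%R ->
     (Rabs ((k (t + u)%R - k t) / u - c) < eps / 2)%R) ->
  (Rabs h < d)%R -> (Rabs (k (t + h)%R - k t - c * h) <= eps / 2 * Rabs h)%R).
{ intros k c d Hk Hd. destruct (Req_dec h 0) as [->|Hn].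
  - rewrite Rplus_0_r. replace (k t - k t - c * 0)%R with 0%R by ring.
    rewrite Rabs_R0. lra.
  - specialize (Hk h Hn Hd).
    replace (k (t + h)%R - k t - c * h)%R with (((k (t + h) - k t) / h - c) * h)%R
      by (field; auto).
    rewrite Rabs_mult. apply Rmult_le_compat_r; [apply Rabs_pos|lra]. }
replace ((f (t + h)%R, g (t + h)%R) - (f t, g t) - (a, b) * h) with
  ((f (t + h) - f t - a * h)%R, (g (t + h) - g t - b * h)%R)
  by (unfold RtoC, Cminus, Cplus, Copp, Cmult; simpl; f_equal; ring).
eapply Rle_trans; [apply Cmod_pair_le|].
assert (G1 := Haux f a d1 H1 (Rlt_le_trans _ _ _ Hh (Rmin_l _ _))).
assert (G2 := Haux g b d2 H2 (Rlt_le_trans _ _ _ Hh (Rmin_r _ _))).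
lra.
Qed.

Lemma path_deriv_eq (g : R -> C) (t : R) (l l' : C) :
  path_deriv g t l -> l = l' -> path_deriv g t l'.
Proof. now intros H <-. Qed.

Lemma path_deriv_comp (f : C -> C) (g : R -> C) (t : R) (a b : C) :
  Cderiv f (g t) a -> path_deriv g t b -> path_deriv (fun s => f (g s)) t (a * b).
Proof.
intros Hf Hg eps Heps.
assert (Ha := Cmod_ge_0 a). assert (Hb := Cmod_ge_0 b).
(* The error splits into the remainder of [f], at most [e1 |k|] with [|k| <= (1 + |b|) |h|], and
   [|a|] times the remainder of [g]; each receives [eps / 2]. The minimum with 1 in [e2] yields the
   bound on [k]. *)
set (e1 := (eps / (2 * (1 + Cmod b)))%R). set (e2 := Rmin 1 (eps / (2 * (1 + Cmod a)))).
assert (He1 : (0 < e1)%R) by (apply Rdiv_lt_0_compat; lra).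
assert (He2 : (0 < e2)%R) by (apply Rmin_glb_lt; [lra|apply Rdiv_lt_0_compat; lra]).
destruct (Hf e1 He1) as [d1 [Hd1 H1]].
destruct (path_deriv_cont g t b Hg d1 Hd1) as [d2 [Hd2 H2]].
destruct (Hg e2 He2) as [d3 [Hd3 H3]].
exists (Rmin d2 d3); split; [now apply Rmin_glb_lt|]. intros h Hh.
specialize (H2 h (Rlt_le_trans _ _ _ Hh (Rmin_l _ _))).
specialize (H3 h (Rlt_le_trans _ _ _ Hh (Rmin_r _ _))).
specialize (H1 _ H2). rewrite Cplus_minus in H1.
set (k := g (t + h)%R - g t) in *.
replace (f (g (t + h)%R) - f (g t) - a * b * h) with
  ((f (g (t + h)%R) - f (g t) - a * k) + a * (k - b * h)) by ring.
eapply Rle_trans; [apply Cmod_triangle|]. rewrite Cmod_mult.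
assert (Hh0 := Rabs_pos h).
assert (Hk : (Cmod k <= (1 + Cmod b) * Rabs h)%R).
{ replace k with ((k - b * h) + b * h) by ring.
  eapply Rle_trans; [apply Cmod_triangle|]. rewrite Cmod_mult, Cmod_R.
  assert (H4 : (e2 <= 1)%R) by apply Rmin_l. nra. }
assert (H5 : (e1 * Cmod k <= eps / 2 * Rabs h)%R).
{ replace (eps / 2 * Rabs h)%R with (e1 * ((1 + Cmod b) * Rabs h))%R
    by (unfold e1; field; lra).
  apply Rmult_le_compat_l; lra. }
assert (H6 : (Cmod a * Cmod (k - b * h) <= eps / 2 * Rabs h)%R).
{ apply Rle_trans with ((1 + Cmod a) * (eps / (2 * (1 + Cmod a)) * Rabs h))%R.
  - apply Rmult_le_compat; [easy|apply Cmod_ge_0|lra|].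
    eapply Rle_trans; [exact H3|]. apply Rmult_le_compat_r; [easy|apply Rmin_r].
  - right; field; lra. }
lra.
Qed.

Lemma path_deriv_mult (f g : R -> C) (t : R) (a b : C) :
  path_deriv f t a -> path_deriv g t b ->
  path_deriv (fun s => f s * g s) t (a * g t + f t * b).
Proof.
intros Hf Hg eps Heps.
assert (Ha := Cmod_ge_0 a). assert (Hft := Cmod_ge_0 (f t)). assert (Hgt := Cmod_ge_0 (g t)).
set (A := (2 + Cmod a + Cmod (f t) + Cmod (g t))%R).
set (e := Rmin 1 (eps / A)).
assert (He : (0 < e)%R) by (apply Rmin_glb_lt; [lra|apply Rdiv_lt_0_compat; unfold A; lra]).
assert (He1 : (e <= 1)%R) by apply Rmin_l.
assert (HeA : (A * e <= eps)%R).
{ replace eps with (A * (eps / A))%R at 1 by (field; unfold A; lra).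
  apply Rmult_le_compat_l; [unfold A; lra|apply Rmin_r]. }
destruct (Hf e He) as [d1 [Hd1 H1]]. destruct (Hg e He) as [d2 [Hd2 H2]].
destruct (path_deriv_cont g t b Hg e He) as [d3 [Hd3 H3]].
exists (Rmin d1 (Rmin d2 d3)); split; [repeat apply Rmin_glb_lt; easy|]. intros h Hh.
specialize (H1 h (Rlt_le_trans _ _ _ Hh (Rmin_l _ _))).
assert (Hh' := Rlt_le_trans _ _ _ Hh (Rmin_r _ _)).
specialize (H2 h (Rlt_le_trans _ _ _ Hh' (Rmin_l _ _))).
specialize (H3 h (Rlt_le_trans _ _ _ Hh' (Rmin_r _ _))).
replace (f (t + h)%R * g (t + h)%R - f t * g t - (a * g t + f t * b) * h) with
  ((f (t + h)%R - f t - a * h) * g (t + h)%R +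
   (a * h * (g (t + h)%R - g t) + f t * (g (t + h)%R - g t - b * h))) by ring.
eapply Rle_trans; [apply Cmod_triangle|].
eapply Rle_trans; [apply Rplus_le_compat_l, Cmod_triangle|].
rewrite !Cmod_mult, Cmod_R.
assert (H4 : (Cmod (g (t + h)%R) <= Cmod (g t) + 1)%R).
{ eapply Rle_trans; [apply (Cmod_triangle_inv _ (g t))|lra]. }
assert (Hh0 := Rabs_pos h).
set (u := Cmod (f (t + h)%R - f t - a * h)) in *.
set (v := Cmod (g (t + h)%R)) in *.
set (w := Cmod (g (t + h)%R - g t)) in *.
set (q := Cmod (g (t + h)%R - g t - b * h)) in *.
assert (G1 : (u * v <= (e * Rabs h) * (Cmod (g t) + 1))%R)
  by (apply Rmult_le_compat; try apply Cmod_ge_0; easy).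
assert (G2 : (Cmod a * Rabs h * w <= Cmod a * Rabs h * e)%R)
  by (apply Rmult_le_compat_l; [nra|lra]).
assert (G3 : (Cmod (f t) * q <= Cmod (f t) * (e * Rabs h))%R)
  by (apply Rmult_le_compat_l; lra).
apply Rle_trans with (A * e * Rabs h)%R; [|now apply Rmult_le_compat_r].
unfold A. nra.
Qed.

Definition is_CInt (f : R -> C) (a b : R) (l : C) : Prop :=
  is_RInt (V := C_R_NormedModule) f a b l.

Definition CInt (f : R -> C) (a b : R) : C :=
  RInt (V := C_R_CompleteNormedModule) f a b.

Lemma CInt_correct (f : R -> C) (a b : R) : (a <= b)%R ->
  (forall t, (a <= t <= b)%R -> path_cont f t) -> is_CInt f a b (CInt f a b).
Proof.
intros Hab H. apply (RInt_correct (V := C_R_CompleteNormedModule)).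
apply (ex_RInt_continuous (V := C_R_CompleteNormedModule)).
rewrite Rmin_left, Rmax_right by easy.
intros t Ht. now apply path_cont_continuous, H.
Qed.

Lemma is_CInt_unique (f : R -> C) (a b : R) (l : C) : is_CInt f a b l -> CInt f a b = l.
Proof. apply (is_RInt_unique (V := C_R_CompleteNormedModule)). Qed.

Lemma is_CInt_ext (f g : R -> C) (a b : R) (l : C) : (a <= b)%R ->
  (forall t, (a < t < b)%R -> f t = g t) -> is_CInt f a b l -> is_CInt g a b l.
Proof.
intros Hab H. apply is_RInt_ext. now rewrite Rmin_left, Rmax_right by easy.
Qed.

Lemma is_CInt_minus (f g : R -> C) (a b : R) (l m : C) :
  is_CInt f a b l -> is_CInt g a b m -> is_CInt (fun t => f t - g t) a b (l - m).
Proof. apply (is_RInt_minus (V := C_R_NormedModule)). Qed.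

(** The integral is that of a real normed module, whose scalar rule covers real factors only; a
    complex factor is handled through real and imaginary parts. *)
Lemma is_CInt_mult (f : R -> C) (a b : R) (c l : C) :
  is_CInt f a b l -> is_CInt (fun t => c * f t) a b (c * l).
Proof.
intros H.
assert (H1 := is_RInt_fct_extend_fst (U := R_NormedModule) (V := R_NormedModule) f a b l H).
assert (H2 := is_RInt_fct_extend_snd (U := R_NormedModule) (V := R_NormedModule) f a b l H).
apply (is_RInt_fct_extend_pair (U := R_NormedModule) (V := R_NormedModule)); simpl.
- apply (is_RInt_minus (V := R_NormedModule));
    now apply (is_RInt_scal (V := R_NormedModule)).
- apply (is_RInt_plus (V := R_NormedModule));
    now apply (is_RInt_scal (V := R_NormedModule)).
Qed.

Lemma is_CInt_bound (f : R -> C) (a b M : R) (l : C) : (a <= b)%R ->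
  (forall t, (a <= t <= b)%R -> (Cmod (f t) <= M)%R) ->
  is_CInt f a b l -> (Cmod l <= (b - a) * M)%R.
Proof.
intros Hab H Hl. rewrite <- norm_C_R.
apply (norm_RInt_le_const (V := C_R_NormedModule) f a b l M Hab); [|exact Hl].
intros t Ht. rewrite norm_C_R. now apply H.
Qed.

Lemma is_CInt_deriv (g dg : R -> C) (a b : R) : (a <= b)%R ->
  (forall t, (a <= t <= b)%R -> path_deriv g t (dg t)) ->
  (forall t, (a <= t <= b)%R -> path_cont dg t) ->
  is_CInt dg a b (g b - g a).
Proof.
intros Hab H1 H2.
apply (is_RInt_derive (V := C_R_CompleteNormedModule) g dg);
  rewrite Rmin_left, Rmax_right by easy; intros t Ht.
- now apply path_deriv_is_derive, H1.
- now apply path_cont_continuous, H2.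
Qed.

(** * Goursat's theorem and primitives *)

Definition seg (a b : C) (t : R) : C := a + t * (b - a).

(** The contour integral of [f] along the segment, with the constant velocity [b - a] taken out of
    the integral. *)
Definition Seg (f : C -> C) (a b : C) : C :=
  (b - a) * CInt (fun t => f (seg a b t)) 0 1.

Definition Ccont_disc (f : C -> C) : Prop := forall z, unit_disc z -> Ccont f z.

Lemma seg_Cmod (a b : C) (t r : R) : (0 <= t <= 1)%R ->
  (Cmod a <= r)%R -> (Cmod b <= r)%R -> (Cmod (seg a b t) <= r)%R.
Proof.
intros Ht Ha Hb. unfold seg.
replace (a + t * (b - a)) with (RtoC (1 - t) * a + t * b)
  by (rewrite RtoC_minus; ring).
eapply Rle_trans; [apply Cmod_triangle|].
rewrite !Cmod_mult, !Cmod_R, !Rabs_pos_eq by lra. nra.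
Qed.

Lemma seg_disc (a b : C) (t : R) : (0 <= t <= 1)%R ->
  unit_disc a -> unit_disc b -> unit_disc (seg a b t).
Proof.
unfold unit_disc. intros Ht Ha Hb.
apply Rle_lt_trans with (Rmax (Cmod a) (Cmod b)); [|now apply Rmax_lub_lt].
apply seg_Cmod; [easy|apply Rmax_l|apply Rmax_r].
Qed.

Lemma seg_minus (a b : C) (t : R) : (0 <= t <= 1)%R ->
  (Cmod (seg a b t - a) <= Cmod (b - a))%R.
Proof.
intros Ht. unfold seg. rewrite Cplus_minus_l, Cmod_mult, Cmod_R, Rabs_pos_eq by lra.
assert (H := Cmod_ge_0 (b - a)). nra.
Qed.

Lemma path_deriv_seg (a b : C) (t : R) : path_deriv (seg a b) t (b - a).
Proof.
intros eps Heps. exists 1%R; split; [lra|]. intros h _.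
replace (seg a b (t + h) - seg a b t - (b - a) * h) with (RtoC 0)
  by (unfold seg; rewrite RtoC_plus; ring).
rewrite Cmod_0. apply Rmult_le_pos; [lra|apply Rabs_pos].
Qed.

Lemma path_cont_seg (f : C -> C) (a b : C) (t : R) :
  Ccont f (seg a b t) -> path_cont (fun s => f (seg a b s)) t.
Proof.
intros H. apply (path_cont_comp f); [exact H|].
apply (path_deriv_cont _ _ (b - a)), path_deriv_seg.
Qed.

Lemma is_CInt_Seg (f : C -> C) (a b : C) : Ccont_disc f -> unit_disc a -> unit_disc b ->
  is_CInt (fun t => f (seg a b t)) 0 1 (CInt (fun t => f (seg a b t)) 0 1).
Proof.
intros Hf Ha Hb. apply CInt_correct; [lra|]. intros t Ht.
apply path_cont_seg, Hf. now apply seg_disc.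
Qed.

Lemma Seg_bound (f : C -> C) (a b : C) (M : R) :
  Ccont_disc f -> unit_disc a -> unit_disc b ->
  (forall t, (0 <= t <= 1)%R -> (Cmod (f (seg a b t)) <= M)%R) ->
  (Cmod (Seg f a b) <= M * Cmod (b - a))%R.
Proof.
intros Hf Ha Hb H. unfold Seg. rewrite Cmod_mult, Rmult_comm.
apply Rmult_le_compat_r; [apply Cmod_ge_0|].
replace M with ((1 - 0) * M)%R by ring.
apply (is_CInt_bound (fun t => f (seg a b t))); [lra|exact H|].
now apply is_CInt_Seg.
Qed.

Lemma is_CInt_comp_lin (f : R -> C) (u v a b : R) (l : C) :
  is_CInt f (u * a + v) (u * b + v) l -> is_CInt (fun y => RtoC u * f (u * y + v)%R) a b l.
Proof.
intros H. apply (is_RInt_comp_lin (V := C_R_NormedModule)) in H.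
eapply is_RInt_ext; [|exact H]. intros t _. apply (scal_R_Cmult u (f (u * t + v)%R)).
Qed.

Lemma Seg_swap (f : C -> C) (a b : C) : Ccont_disc f -> unit_disc a -> unit_disc b ->
  Seg f b a = - Seg f a b.
Proof.
intros Hf Ha Hb. unfold Seg.
assert (H := is_CInt_Seg f a b Hf Ha Hb).
set (l := CInt (fun t => f (seg a b t)) 0 1) in *.
rewrite (is_CInt_unique _ 0 1 l); [ring|].
(* Reversal is the substitution [t -> 1 - t]: the inner factor [-1] is its Jacobian, the outer one
   compensates for it. *)
replace l with (RtoC (-1) * - l) by ring.
apply (is_CInt_ext (fun t => RtoC (-1) * (RtoC (-1) * f (seg a b (-1 * t + 1))))); [lra| |].
- intros t _. unfold seg.
  replace (a + (-1 * t + 1)%R * (b - a)) with (b + t * (a - b))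
    by (rewrite RtoC_plus, RtoC_mult; ring).
  ring.
- apply is_CInt_mult.
  apply (is_CInt_comp_lin (fun t => f (seg a b t))).
  replace (-1 * 0 + 1)%R with 1%R by ring. replace (-1 * 1 + 1)%R with 0%R by ring.
  exact (is_RInt_swap (V := C_R_NormedModule) _ _ _ _ H).
Qed.

Definition mid (a b : C) : C := (a + b) / 2.

Lemma mid_disc (a b : C) (r : R) : (Cmod a <= r)%R -> (Cmod b <= r)%R -> (Cmod (mid a b) <= r)%R.
Proof.
intros Ha Hb. unfold mid. rewrite Cmod_div by (intros E; apply RtoC_inj in E; lra).
rewrite Cmod_R, (Rabs_pos_eq 2) by lra.
assert (H := Cmod_triangle a b). lra.
Qed.

Lemma C2_neq0 : RtoC 2 <> 0.
Proof. intros E; apply RtoC_inj in E; lra. Qed.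

Lemma Seg_split (f : C -> C) (a b : C) : Ccont_disc f -> unit_disc a -> unit_disc b ->
  Seg f a b = Seg f a (mid a b) + Seg f (mid a b) b.
Proof.
intros Hf Ha Hb. unfold Seg.
assert (Hc : forall t, (0 <= t <= 1)%R -> path_cont (fun s => f (seg a b s)) t).
{ intros t Ht. apply path_cont_seg, Hf. now apply seg_disc. }
assert (H1 : is_CInt (fun t => f (seg a b t)) 0 (/ 2) (CInt (fun t => f (seg a b t)) 0 (/ 2))).
{ apply CInt_correct; [lra|]. intros t Ht. apply Hc. lra. }
assert (H2 : is_CInt (fun t => f (seg a b t)) (/ 2) 1 (CInt (fun t => f (seg a b t)) (/ 2) 1)).
{ apply CInt_correct; [lra|]. intros t Ht. apply Hc. lra. }
set (l1 := CInt (fun t => f (seg a b t)) 0 (/ 2)) in *.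
set (l2 := CInt (fun t => f (seg a b t)) (/ 2) 1) in *.
assert (Hh : RtoC (/ 2) = / 2) by (apply RtoC_inv; lra).
rewrite (is_CInt_unique _ 0 1 (l1 + l2)); cycle 1.
{ exact (is_RInt_Chasles (V := C_R_NormedModule) _ _ _ _ _ _ H1 H2). }
(* Each half is stretched back to [[0, 1]]. The factor 2 undoes the Jacobian [1 / 2] and is absorbed
   at the end by the halved velocity. *)
rewrite (is_CInt_unique (fun t => f (seg a (mid a b) t)) 0 1 (2 * l1)); cycle 1.
{ apply (is_CInt_ext (fun t => 2 * (RtoC (/ 2) * f (seg a b (/ 2 * t + 0))))); [lra| |].
  - intros t _. rewrite Hh. unfold seg, mid.
    replace (a + (/ 2 * t + 0)%R * (b - a)) with (a + t * ((a + b) / 2 - a))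
      by (rewrite RtoC_plus, RtoC_mult, Hh; field; apply C2_neq0).
    field.
  - apply is_CInt_mult, (is_CInt_comp_lin (fun t => f (seg a b t))).
    now replace (/ 2 * 0 + 0)%R with 0%R by ring; replace (/ 2 * 1 + 0)%R with (/ 2)%R by ring. }
rewrite (is_CInt_unique (fun t => f (seg (mid a b) b t)) 0 1 (2 * l2)); cycle 1.
{ apply (is_CInt_ext (fun t => 2 * (RtoC (/ 2) * f (seg a b (/ 2 * t + / 2))))); [lra| |].
  - intros t _. rewrite Hh. unfold seg, mid.
    replace (a + (/ 2 * t + / 2)%R * (b - a)) with ((a + b) / 2 + t * (b - (a + b) / 2))
      by (rewrite RtoC_plus, RtoC_mult, Hh; field; apply C2_neq0).
    field.
  - apply is_CInt_mult, (is_CInt_comp_lin (fun t => f (seg a b t))).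
    now replace (/ 2 * 0 + / 2)%R with (/ 2)%R by ring; replace (/ 2 * 1 + / 2)%R with 1%R by field. }
unfold mid. field.
Qed.

Lemma Seg_primitive (F f : C -> C) (a b : C) :
  (forall z, unit_disc z -> Cderiv F z (f z)) -> Ccont_disc f ->
  unit_disc a -> unit_disc b -> Seg f a b = F b - F a.
Proof.
intros HF Hf Ha Hb. unfold Seg.
assert (H : is_CInt (fun t => f (seg a b t) * (b - a)) 0 1 (F (seg a b 1) - F (seg a b 0))).
{ apply (is_CInt_deriv (fun t => F (seg a b t))); [lra| |]; intros t Ht.
  - apply path_deriv_comp; [|apply path_deriv_seg]. apply HF. now apply seg_disc.
  - apply (path_cont_mult (fun t => f (seg a b t)) (fun _ => b - a)).
    + apply path_cont_seg, Hf. now apply seg_disc.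
    + intros eps Heps. exists 1%R; split; [lra|]. intros h _.
      unfold Cminus at 1. rewrite Cplus_opp_r, Cmod_0. exact Heps. }
assert (H2 := is_CInt_mult _ _ _ (b - a) _ (is_CInt_Seg f a b Hf Ha Hb)).
apply (is_CInt_ext _ (fun t => f (seg a b t) * (b - a))) in H2; [|lra|intros; ring].
apply is_CInt_unique in H. apply is_CInt_unique in H2.
rewrite <- H2, H. unfold seg. f_equal; [f_equal; ring|f_equal; f_equal; ring].
Qed.

Lemma Seg_minus (f g : C -> C) (a b : C) : Ccont_disc f -> Ccont_disc g ->
  unit_disc a -> unit_disc b -> Seg (fun z => f z - g z) a b = Seg f a b - Seg g a b.
Proof.
intros Hf Hg Ha Hb. unfold Seg.
rewrite (is_CInt_unique _ 0 1 _
  (is_CInt_minus _ _ _ _ _ _ (is_CInt_Seg f a b Hf Ha Hb) (is_CInt_Seg g a b Hg Ha Hb))).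
ring.
Qed.

(** * Triangles and their subdivision by midpoints *)

Definition Tri (f : C -> C) (T : C * C * C) : C :=
  let '(a, b, c) := T in Seg f a b + Seg f b c + Seg f c a.

Definition perim (T : C * C * C) : R :=
  let '(a, b, c) := T in (Cmod (b - a) + Cmod (c - b) + Cmod (a - c))%R.

(** A closed disc of radius [r < 1] is convex, hence inherited by subtriangles, and it keeps the
    limit point of a nested sequence away from the unit circle. *)
Definition tri_in (r : R) (T : C * C * C) : Prop :=
  let '(a, b, c) := T in (Cmod a <= r /\ Cmod b <= r /\ Cmod c <= r)%R.

(** The vertices are ordered so that all four pieces have the orientation of [T]: each inner edge is
    then traversed once in either direction and cancels. *)
Definition sub1 (T : C * C * C) := let '(a, b, c) := T in (a, mid a b, mid c a).
Definition sub2 (T : C * C * C) := let '(a, b, c) := T in (mid a b, b, mid b c).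
Definition sub3 (T : C * C * C) := let '(a, b, c) := T in (mid c a, mid b c, c).
Definition sub4 (T : C * C * C) := let '(a, b, c) := T in (mid a b, mid b c, mid c a).

Lemma Tri_quad (f : C -> C) (T : C * C * C) (r : R) : Ccont_disc f -> (r < 1)%R -> tri_in r T ->
  Tri f T = Tri f (sub1 T) + Tri f (sub2 T) + Tri f (sub3 T) + Tri f (sub4 T).
Proof.
intros Hf Hr. destruct T as [[a b] c]. intros (Ha & Hb & Hc). simpl.
assert (Hd : forall z, (Cmod z <= r)%R -> unit_disc z)
  by (intros z Hz; unfold unit_disc; lra).
assert (Hab := mid_disc a b r Ha Hb). assert (Hbc := mid_disc b c r Hb Hc).
assert (Hca := mid_disc c a r Hc Ha).
rewrite (Seg_split f a b), (Seg_split f b c), (Seg_split f c a) by auto.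
rewrite (Seg_swap f (mid c a) (mid a b)), (Seg_swap f (mid a b) (mid b c)),
  (Seg_swap f (mid b c) (mid c a)) by auto.
ring.
Qed.

Lemma Cmod_half (v : C) : Cmod (v / 2) = (Cmod v / 2)%R.
Proof.
rewrite Cmod_div by apply C2_neq0. now rewrite Cmod_R, (Rabs_pos_eq 2) by lra.
Qed.

Lemma Cmod_eq_half (u v : C) : u = v / 2 \/ u = - (v / 2) -> Cmod u = (Cmod v / 2)%R.
Proof. intros [-> | ->]; rewrite ?Cmod_opp; apply Cmod_half. Qed.

Definition vertex (T : C * C * C) : C := fst (fst T).

Lemma perim_ge0 (T : C * C * C) : (0 <= perim T)%R.
Proof.
destruct T as [[a b] c]. simpl.
assert (H1 := Cmod_ge_0 (b - a)). assert (H2 := Cmod_ge_0 (c - b)).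
assert (H3 := Cmod_ge_0 (a - c)). lra.
Qed.

Definition is_sub (T S : C * C * C) : Prop :=
  S = sub1 T \/ S = sub2 T \/ S = sub3 T \/ S = sub4 T.

Lemma Cmod_sum_half (u1 u2 u3 v1 v2 v3 : C) :
  u1 = v1 / 2 \/ u1 = - (v1 / 2) -> u2 = v2 / 2 \/ u2 = - (v2 / 2) ->
  u3 = v3 / 2 \/ u3 = - (v3 / 2) ->
  (Cmod u1 + Cmod u2 + Cmod u3 = (Cmod v1 + Cmod v2 + Cmod v3) / 2)%R.
Proof.
intros H1 H2 H3.
rewrite (Cmod_eq_half _ _ H1), (Cmod_eq_half _ _ H2), (Cmod_eq_half _ _ H3). field.
Qed.

Lemma is_sub_perim (T S : C * C * C) : is_sub T S -> perim S = (perim T / 2)%R.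
Proof.
destruct T as [[a b] c]. intros [-> | [-> | [-> | ->]]]; simpl; unfold mid;
  try (apply Cmod_sum_half; left; field).
(* Only the medial triangle [sub4] is left; its sides are minus half the sides of [T], in rotated
   order. *)
rewrite (Cmod_sum_half _ _ _ (a - c) (b - a) (c - b)) by (right; field).
f_equal; ring.
Qed.

Lemma is_sub_in (T S : C * C * C) (r : R) : is_sub T S -> tri_in r T -> tri_in r S.
Proof.
destruct T as [[a b] c]. intros H (Ha & Hb & Hc).
assert (Hab := mid_disc a b r Ha Hb). assert (Hbc := mid_disc b c r Hb Hc).
assert (Hca := mid_disc c a r Hc Ha).
now destruct H as [-> | [-> | [-> | ->]]]; simpl.
Qed.

Lemma is_sub_vertex (T S : C * C * C) : is_sub T S ->
  (Cmod (vertex S - vertex T) <= perim T)%R.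
Proof.
destruct T as [[a b] c]. unfold vertex.
assert (H1 := Cmod_ge_0 (b - a)). assert (H2 := Cmod_ge_0 (c - b)).
assert (H3 := Cmod_ge_0 (a - c)).
intros [-> | [-> | [-> | ->]]]; simpl; unfold mid.
- replace (a - a) with (RtoC 0) by ring. rewrite Cmod_0. lra.
- rewrite (Cmod_eq_half _ (b - a)) by (left; field). lra.
- rewrite (Cmod_eq_half _ (a - c)) by (right; field). lra.
- rewrite (Cmod_eq_half _ (b - a)) by (left; field). lra.
Qed.

(** The square makes the threshold drop to a quarter when the perimeter is halved, which matches a
    division of the integral among four pieces: badness passes to a piece with the same [eps]. *)
Definition bad_tri (f : C -> C) (eps : R) (T : C * C * C) : Prop :=
  (eps * perim T ^ 2 < Cmod (Tri f T))%R.

(** The last branch is taken without a test: if the first three pieces are not bad, [next_bad] shows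
    that [sub4] is. *)
Definition next_tri (f : C -> C) (eps : R) (T : C * C * C) : C * C * C :=
  let bad S := Rlt_dec (eps * perim S ^ 2) (Cmod (Tri f S)) in
  if bad (sub1 T) then sub1 T else if bad (sub2 T) then sub2 T
  else if bad (sub3 T) then sub3 T else sub4 T.

Lemma next_is_sub (f : C -> C) (eps : R) (T : C * C * C) : is_sub T (next_tri f eps T).
Proof. unfold next_tri, is_sub. repeat destruct Rlt_dec; auto. Qed.

Lemma next_bad (f : C -> C) (eps r : R) (T : C * C * C) : Ccont_disc f -> (r < 1)%R ->
  tri_in r T -> bad_tri f eps T -> bad_tri f eps (next_tri f eps T).
Proof.
intros Hf Hr HT HB. unfold bad_tri, next_tri in *.
destruct Rlt_dec as [H1|H1]; [easy|]. destruct Rlt_dec as [H2|H2]; [easy|].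
destruct Rlt_dec as [H3|H3]; [easy|].
rewrite (Tri_quad f T r Hf Hr HT) in HB.
rewrite (is_sub_perim T (sub1 T)) in H1 by (unfold is_sub; auto).
rewrite (is_sub_perim T (sub2 T)) in H2 by (unfold is_sub; auto).
rewrite (is_sub_perim T (sub3 T)) in H3 by (unfold is_sub; auto).
rewrite (is_sub_perim T (sub4 T)) by (unfold is_sub; auto).
assert (G1 := Cmod_triangle (Tri f (sub1 T) + Tri f (sub2 T) + Tri f (sub3 T)) (Tri f (sub4 T))).
assert (G2 := Cmod_triangle (Tri f (sub1 T) + Tri f (sub2 T)) (Tri f (sub3 T))).
assert (G3 := Cmod_triangle (Tri f (sub1 T)) (Tri f (sub2 T))).
replace (eps * (perim T / 2) ^ 2)%R with (eps * perim T ^ 2 / 4)%R in * by field.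
lra.
Qed.

(** Completeness with a rate: the tail of the geometric series from [n] on sums to [2 M / 2^n]. The
    rate is what allows the limit to be compared with the [n]-th triangle on the scale of its own
    perimeter. *)
Lemma geometric_cauchy (v : nat -> R) (M : R) : (0 <= M)%R ->
  (forall n, (Rabs (v (S n) - v n) <= M * (/ 2) ^ n)%R) ->
  exists l : R, forall n, (Rabs (l - v n) <= 2 * M * (/ 2) ^ n)%R.
Proof.
intros HM Hv.
assert (Hp : forall n, (0 < (/ 2) ^ n)%R) by (intros n; apply pow_lt; lra).
(* Keeping the remaining tail as a subtracted term is what makes the induction on [k] close. *)
assert (Hk : forall n k, (Rabs (v (n + k)%nat - v n) <= 2 * M * (/ 2) ^ n - 2 * M * (/ 2) ^ (n + k))%R).
{ intros n k. induction k as [|k IH].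
  - rewrite Nat.add_0_r, !Rminus_diag, Rabs_R0. lra.
  - rewrite Nat.add_succ_r. specialize (Hv (n + k)%nat). simpl.
    replace (v (S (n + k)) - v n)%R with ((v (S (n + k)) - v (n + k)%nat) + (v (n + k)%nat - v n))%R
      by ring.
    eapply Rle_trans; [apply Rabs_triang|]. lra. }
assert (Hc : ex_lim_seq_cauchy v).
{ intros eps.
  destruct (pow_lt_1_zero (/ 2) ltac:(rewrite Rabs_pos_eq; lra) (eps / (2 * (2 * M + 1)))%R) as [N HN].
  { apply Rdiv_lt_0_compat; [apply cond_pos|lra]. }
  exists N. intros n m Hn Hm.
  assert (Hb : forall i, (N <= i)%nat -> (Rabs (v i - v N) < eps / 2)%R).
  { intros i Hi. replace i with (N + (i - N))%nat by lia.
    eapply Rle_lt_trans; [apply Hk|].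
    specialize (HN N (le_n N)). rewrite Rabs_pos_eq in HN by (left; apply Hp).
    assert (H0 := Hp (N + (i - N))%nat). assert (H1 := Hp N).
    apply Rle_lt_trans with ((2 * M + 1) * (/ 2) ^ N - 0)%R; [nra|].
    apply (Rmult_lt_compat_l (2 * M + 1)) in HN; [|lra].
    replace ((2 * M + 1) * (eps / (2 * (2 * M + 1))))%R with (eps / 2)%R in HN by (field; lra).
    lra. }
  replace (v n - v m)%R with ((v n - v N) - (v m - v N))%R by ring.
  eapply Rle_lt_trans; [apply Rabs_triang|]. rewrite Rabs_Ropp.
  assert (H1 := Hb n Hn). assert (H2 := Hb m Hm). lra. }
apply ex_lim_seq_cauchy_corr in Hc. destruct Hc as [l Hl].
exists l. intros n.
apply le_epsilon. intros eps Heps.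
apply is_lim_seq_spec in Hl. destruct (Hl (mkposreal eps Heps)) as [N HN]. simpl in HN.
specialize (HN (n + N)%nat ltac:(lia)). specialize (Hk n N).
replace (l - v n)%R with (- (v (n + N)%nat - l) + (v (n + N)%nat - v n))%R by ring.
eapply Rle_trans; [apply Rabs_triang|]. rewrite Rabs_Ropp.
assert (H1 := Hp (n + N)%nat). nra.
Qed.

Lemma Cgeometric_cauchy (v : nat -> C) (M : R) : (0 <= M)%R ->
  (forall n, (Cmod (v (S n) - v n) <= M * (/ 2) ^ n)%R) ->
  exists l : C, forall n, (Cmod (l - v n) <= 4 * M * (/ 2) ^ n)%R.
Proof.
intros HM Hv.
destruct (geometric_cauchy (fun n => fst (v n)) M HM) as [l1 H1].
{ intros n. eapply Rle_trans; [|apply Hv].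
  eapply Rle_trans; [|apply Rmax_Cmod]. apply (Rmax_l (Rabs (fst (v (S n) - v n)))). }
destruct (geometric_cauchy (fun n => snd (v n)) M HM) as [l2 H2].
{ intros n. eapply Rle_trans; [|apply Hv].
  eapply Rle_trans; [|apply Rmax_Cmod]. apply (Rmax_r _ (Rabs (snd (v (S n) - v n)))). }
exists (l1, l2). intros n. specialize (H1 n). specialize (H2 n).
replace ((l1, l2) - v n) with ((l1 - fst (v n))%R, (l2 - snd (v n))%R) by reflexivity.
eapply Rle_trans; [apply Cmod_pair_le|]. lra.
Qed.

(** The bound [M] is required only near [vertex T], so that a local approximation of [f] can be
    inserted. The radius covers the way to the start of a side plus the length of that side. *)
Lemma Tri_bound (f : C -> C) (T : C * C * C) (r M : R) : Ccont_disc f -> (r < 1)%R ->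
  tri_in r T ->
  (forall z, unit_disc z -> (Cmod (z - vertex T) <= 2 * perim T)%R -> (Cmod (f z) <= M)%R) ->
  (Cmod (Tri f T) <= M * perim T)%R.
Proof.
intros Hf Hr. destruct T as [[a b] c]. intros (Ha & Hb & Hc). unfold vertex; simpl.
assert (H1 := Cmod_ge_0 (b - a)). assert (H2 := Cmod_ge_0 (c - b)).
assert (H3 := Cmod_ge_0 (a - c)). intros HM.
assert (Hd : forall z, (Cmod z <= r)%R -> unit_disc z)
  by (intros z Hz; unfold unit_disc; lra).
assert (Hs : forall u v, (Cmod u <= r)%R -> (Cmod v <= r)%R ->
  (Cmod (u - a) + Cmod (v - u) <= 2 * (Cmod (b - a) + Cmod (c - b) + Cmod (a - c)))%R ->
  (Cmod (Seg f u v) <= M * Cmod (v - u))%R).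
{ intros u v Hu Hv Huv. apply Seg_bound; auto.
  intros t Ht. apply HM; [apply seg_disc; auto|].
  replace (seg u v t - a) with ((u - a) + (seg u v t - u)) by ring.
  eapply Rle_trans; [apply Cmod_triangle|]. assert (H := seg_minus u v t Ht). lra. }
assert (G1 := Hs a b Ha Hb). assert (G2 := Hs b c Hb Hc). assert (G3 := Hs c a Hc Ha).
replace (a - a) with (RtoC 0) in G1 by ring. rewrite Cmod_0 in G1.
rewrite (Cmod_minus_sym c a) in G3.
eapply Rle_trans; [apply Cmod_triangle|].
eapply Rle_trans; [apply Rplus_le_compat_r, Cmod_triangle|]. lra.
Qed.

Lemma Ccont_const (c : C) (z : C) : Ccont (fun _ => c) z.
Proof. apply (Cderiv_Ccont _ z 0), Cderiv_const. Qed.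

(** A nonzero integral would give a nested sequence of bad triangles. At their limit point [f] is
    affine up to a small multiple of the distance; the affine part has a primitive and integrates to
    0, and the rest is too small for a bad triangle. *)
Lemma goursat (f df : C -> C) (a b c : C) :
  (forall z, unit_disc z -> Cderiv f z (df z)) ->
  unit_disc a -> unit_disc b -> unit_disc c ->
  Seg f a b + Seg f b c + Seg f c a = 0.
Proof.
intros Hdf Ha Hb Hc. change (Tri f (a, b, c) = 0).
assert (Hf : Ccont_disc f) by (intros z Hz; apply (Cderiv_Ccont _ _ (df z)), Hdf, Hz).
set (T0 := (a, b, c)).
set (r := Rmax (Cmod a) (Rmax (Cmod b) (Cmod c))).
assert (Hr : (r < 1)%R) by (unfold r; repeat apply Rmax_lub_lt; assumption).
assert (HT0 : tri_in r T0).
{ unfold r; repeat split; [apply Rmax_l| |];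
  (eapply Rle_trans; [|apply Rmax_r]); [apply Rmax_l|apply Rmax_r]. }
assert (HP := perim_ge0 T0). set (P := perim T0) in *.
apply Cmod_eq_0, Rle_antisym; [|apply Cmod_ge_0].
apply Rnot_lt_le. intros Hpos.
assert (HP2 : (0 <= P ^ 2)%R) by apply pow2_ge_0.
(* Chosen so that [T0] is bad; adding 1 avoids a division by zero when the triangle degenerates to a
   point. *)
set (eps := (Cmod (Tri f T0) / (2 * (P ^ 2 + 1)))%R).
assert (Heps : (0 < eps)%R) by (apply Rdiv_lt_0_compat; lra).
assert (HB : bad_tri f eps T0).
{ unfold bad_tri. fold P.
  replace (Cmod (Tri f T0)) with (eps * (2 * (P ^ 2 + 1)))%R by (unfold eps; field; lra).
  nra. }
set (T := fix T n := match n with O => T0 | S n => next_tri f eps (T n) end).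
assert (HT : forall n, tri_in r (T n) /\ bad_tri f eps (T n) /\ perim (T n) = (P * (/ 2) ^ n)%R).
{ induction n as [|n (I1 & I2 & I3)]; simpl T.
  - rewrite Rmult_1_r. auto.
  - repeat split.
    + now apply (is_sub_in (T n)); [apply next_is_sub|].
    + now apply (next_bad f eps r).
    + rewrite (is_sub_perim (T n)) by apply next_is_sub. rewrite I3. simpl. field. }
destruct (Cgeometric_cauchy (fun n => vertex (T n)) P HP) as [z0 Hz0].
{ intros n. destruct (HT n) as (_ & _ & <-). apply is_sub_vertex. simpl. apply next_is_sub. }
assert (Hp : forall n, (0 < (/ 2) ^ n)%R) by (intros n; apply pow_lt; lra).
assert (Hsmall : forall d : R, (0 < d)%R -> exists n, (P * (/ 2) ^ n < d)%R).
{ intros d Hd.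
  destruct (pow_lt_1_zero (/ 2) ltac:(rewrite Rabs_pos_eq; lra) (d / (P + 1))%R) as [N HN].
  { apply Rdiv_lt_0_compat; lra. }
  exists N. specialize (HN N (le_n N)). rewrite Rabs_pos_eq in HN by (left; apply Hp).
  apply (Rmult_lt_compat_l (P + 1)) in HN; [|lra].
  replace ((P + 1) * (d / (P + 1)))%R with d in HN by (field; lra).
  assert (H := Hp N). lra. }
assert (Hz0d : unit_disc z0).
{ unfold unit_disc. destruct (Hsmall ((1 - r) / 4)%R) as [n Hn]; [lra|].
  specialize (Hz0 n). destruct (HT n) as (H1 & _ & _).
  assert (H2 : (Cmod (vertex (T n)) <= r)%R).
  { destruct (T n) as [[u v] w]. apply H1. }
  assert (H3 := Cmod_triangle_inv z0 (vertex (T n))). lra. }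
(* The first-order Taylor polynomial of [f] at [z0], followed by a primitive of it. *)
set (g := fun z => f z0 + df z0 * (z - z0)).
set (G := fun z => f z0 * z + df z0 / 2 * ((z - z0) * (z - z0))).
assert (HG : forall z, Cderiv G z (g z)).
{ intros z. eapply Cderiv_eq.
  - apply Cderiv_plus; apply Cderiv_mult; try apply Cderiv_const; [apply Cderiv_id|].
    apply Cderiv_mult; apply Cderiv_minus; (apply Cderiv_id || apply Cderiv_const).
  - unfold g. field. }
assert (Hg : Ccont_disc g).
{ intros z _. eapply Cderiv_Ccont. apply Cderiv_plus; [apply Cderiv_const|].
  apply Cderiv_mult; [apply Cderiv_const|].
  apply Cderiv_minus; [apply Cderiv_id|apply Cderiv_const]. }
assert (Hfg : Ccont_disc (fun z => f z - g z)).
{ intros z Hz. eapply Cderiv_Ccont. apply Cderiv_minus; [now apply Hdf|].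
  unfold g. apply Cderiv_plus; [apply Cderiv_const|].
  apply Cderiv_mult; [apply Cderiv_const|].
  apply Cderiv_minus; [apply Cderiv_id|apply Cderiv_const]. }
(* The vertex of the [n]-th triangle is within [4 * perim] of [z0] and the points considered are
   within [2 * perim] of the vertex, in all [6 * perim]. Dividing by 6 turns the error into
   [eps * perim] and the integral into at most [eps * perim^2]; the 7 below places these points
   inside the radius [d]. *)
destruct (Hdf z0 Hz0d (eps / 6)%R) as [d [Hd Hloc]]; [lra|].
destruct (Hsmall (d / 7)%R) as [n Hn]; [lra|].
destruct (HT n) as (H1 & H2 & H3). specialize (Hz0 n).
assert (Htri : Tri f (T n) = Tri (fun z => f z - g z) (T n)).
{ destruct (T n) as [[u v] w]. destruct H1 as (Hu & Hv & Hw).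
  assert (Hdd : forall z, (Cmod z <= r)%R -> unit_disc z)
    by (intros z Hz; unfold unit_disc; lra).
  simpl. rewrite !Seg_minus by auto.
  rewrite !(Seg_primitive G g) by auto. ring. }
assert (Hle : (Cmod (Tri f (T n)) <= (eps / 6 * (6 * perim (T n))) * perim (T n))%R).
{ rewrite Htri. apply (Tri_bound _ _ r); auto.
  intros z Hz Hzv.
  assert (Hzz : (Cmod (z - z0) <= 6 * perim (T n))%R).
  { replace (z - z0) with ((z - vertex (T n)) - (z0 - vertex (T n))) by ring.
    eapply Rle_trans; [apply Cmod_triangle_minus|]. rewrite H3 in *. lra. }
  specialize (Hloc (z - z0)). rewrite Cplus_minus in Hloc.
  replace (f z - g z) with (f z - f z0 - df z0 * (z - z0)) by (unfold g; ring).
  eapply Rle_trans; [apply Hloc; rewrite H3 in Hzz; lra|].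
  apply Rmult_le_compat_l; lra. }
unfold bad_tri in H2. lra.
Qed.

Lemma disc_open (z : C) : unit_disc z ->
  exists d : R, (0 < d)%R /\ forall h, (Cmod h < d)%R -> unit_disc (z + h).
Proof.
unfold unit_disc. intros Hz. exists (1 - Cmod z)%R; split; [lra|].
intros h Hh. assert (H := Cmod_triangle z h). lra.
Qed.

(** The primitive is the integral along the radius from 0. Goursat on the triangle [0, z, z + h]
    turns its increment into the integral over the short segment from [z] to [z + h], where [f] is
    within [eps] of [f z]. *)
Lemma disc_primitive (f df : C -> C) : (forall z, unit_disc z -> Cderiv f z (df z)) ->
  exists F : C -> C, forall z, unit_disc z -> Cderiv F z (f z).
Proof.
intros Hdf.
assert (Hf : Ccont_disc f) by (intros z Hz; apply (Cderiv_Ccont _ _ (df z)), Hdf, Hz).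
assert (H0 : unit_disc 0) by (unfold unit_disc; rewrite Cmod_0; lra).
exists (Seg f 0). intros z Hz eps Heps.
destruct (disc_open z Hz) as [d1 [Hd1 H1]].
destruct (Hf z Hz eps Heps) as [d2 [Hd2 H2]].
exists (Rmin d1 d2); split; [now apply Rmin_glb_lt|]. intros h Hh.
assert (Hzh : unit_disc (z + h)) by (apply H1; eapply Rlt_le_trans; [exact Hh|apply Rmin_l]).
assert (HT := goursat f df 0 z (z + h) Hdf H0 Hz Hzh).
rewrite (Seg_swap f 0 (z + h)) in HT by auto.
assert (Hc : Seg (fun _ => f z) z (z + h) = f z * h).
{ rewrite (Seg_primitive (fun w => f z * w) (fun _ => f z)); auto.
  - ring.
  - intros w _. eapply Cderiv_eq; [apply Cderiv_mult; [apply Cderiv_const|apply Cderiv_id]|cbv beta; ring].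
  - intros w _. apply Ccont_const. }
replace (Seg f 0 (z + h) - Seg f 0 z - f z * h) with
  (Seg f z (z + h) - Seg (fun _ => f z) z (z + h)).
2:{ rewrite Hc. symmetry.
    transitivity (Seg f z (z + h) - f z * h -
      (Seg f 0 z + Seg f z (z + h) + - Seg f 0 (z + h))); [ring|rewrite HT; ring]. }
assert (Hcc : Ccont_disc (fun _ => f z)) by (intros w _; apply Ccont_const).
rewrite <- Seg_minus by auto.
rewrite <- (Cplus_minus_l z h) at 2.
apply Seg_bound; auto.
- intros w Hw e He. destruct (Hf w Hw e He) as [d [Hd H]]. exists d; split; [easy|].
  intros k Hk. replace (f (w + k)%C - f z - (f w - f z)) with (f (w + k)%C - f w) by ring.
  now apply H.
- intros t Ht. left.
  rewrite <- (Cplus_minus z (seg z (z + h) t)). apply H2.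
  eapply Rle_lt_trans; [now apply seg_minus|]. rewrite Cplus_minus_l.
  eapply Rlt_le_trans; [exact Hh|apply Rmin_r].
Qed.

(** * Holomorphic functions are infinitely differentiable *)

Definition Cis (t : R) : C := (cos t, sin t).
Definition Cis_inv (t : R) : C := (cos t, - sin t)%R.

Lemma Cis_Cis_inv (t : R) : Cis t * Cis_inv t = 1.
Proof.
unfold Cis, Cis_inv, Cmult, RtoC; simpl.
assert (H := sin2_cos2 t). unfold Rsqr in H. f_equal; lra.
Qed.

Lemma Cmod_Cis (t : R) : Cmod (Cis t) = 1%R.
Proof.
unfold Cmod, Cis; simpl. replace (_ + _)%R with 1%R; [apply sqrt_1|].
assert (H := sin2_cos2 t). unfold Rsqr in H. lra.
Qed.

Lemma Cmod_Cis_inv (t : R) : Cmod (Cis_inv t) = 1%R.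
Proof.
unfold Cmod, Cis_inv; simpl. replace (_ + _)%R with 1%R; [apply sqrt_1|].
assert (H := sin2_cos2 t). unfold Rsqr in H. lra.
Qed.

Lemma path_deriv_Cis (t : R) : path_deriv Cis t (Ci * Cis t).
Proof.
eapply path_deriv_eq.
- apply (path_deriv_pair cos sin); [apply is_derive_cos|apply is_derive_sin].
- unfold Cis, Ci, Cmult; simpl. f_equal; ring.
Qed.

Lemma path_deriv_Cis_inv (t : R) : path_deriv Cis_inv t (- Ci * Cis_inv t).
Proof.
eapply path_deriv_eq.
- apply (path_deriv_pair cos (fun s => - sin s)%R); [apply is_derive_cos|].
  apply (is_derive_opp (K := R_AbsRing) (V := R_NormedModule)), is_derive_sin.
- unfold Cis_inv, Ci, Cmult, Copp, opp; simpl. f_equal; ring.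
Qed.

Lemma path_cont_const (c : C) (t : R) : path_cont (fun _ => c) t.
Proof.
intros eps Heps. exists 1%R; split; [lra|]. intros h _.
unfold Cminus. now rewrite Cplus_opp_r, Cmod_0.
Qed.

Lemma path_cont_plus (f g : R -> C) (t : R) :
  path_cont f t -> path_cont g t -> path_cont (fun s => f s + g s) t.
Proof.
intros Hf Hg eps Heps.
destruct (Hf (eps / 2)%R) as [d1 [Hd1 H1]]; [lra|].
destruct (Hg (eps / 2)%R) as [d2 [Hd2 H2]]; [lra|].
exists (Rmin d1 d2); split; [now apply Rmin_glb_lt|]. intros h Hh.
specialize (H1 h (Rlt_le_trans _ _ _ Hh (Rmin_l _ _))).
specialize (H2 h (Rlt_le_trans _ _ _ Hh (Rmin_r _ _))).
replace (f (t + h)%R + g (t + h)%R - (f t + g t)) with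
  ((f (t + h)%R - f t) + (g (t + h)%R - g t)) by ring.
eapply Rle_lt_trans; [apply Cmod_triangle|lra].
Qed.

Lemma path_cont_Cis (t : R) : path_cont Cis t.
Proof. eapply path_deriv_cont, path_deriv_Cis. Qed.

Lemma path_cont_Cis_inv (t : R) : path_cont Cis_inv t.
Proof. eapply path_deriv_cont, path_deriv_Cis_inv. Qed.

(** The left side is the modulus of the integral of [f - L] along the segment. The choice [L = f u]
    controls the remainder of [F] uniformly in [u], and [L = 0] with [f = 0] shows that [F] is
    constant. *)
Lemma mean_value_ineq (F f : C -> C) (u v L : C) (M : R) :
  (forall z, unit_disc z -> Cderiv F z (f z)) -> Ccont_disc f ->
  unit_disc u -> unit_disc v ->
  (forall t, (0 <= t <= 1)%R -> (Cmod (f (seg u v t) - L) <= M)%R) ->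
  (Cmod (F v - F u - L * (v - u)) <= M * Cmod (v - u))%R.
Proof.
intros HF Hf Hu Hv HM.
assert (Hc : Ccont_disc (fun z => f z - L)).
{ intros z Hz eps Heps. destruct (Hf z Hz eps Heps) as [d [Hd H]].
  exists d; split; [easy|]. intros h Hh.
  replace (f (z + h)%C - L - (f z - L)) with (f (z + h)%C - f z) by ring. now apply H. }
replace (F v - F u - L * (v - u)) with (Seg (fun z => f z - L) u v).
- now apply Seg_bound.
- rewrite (Seg_primitive (fun z => F z - L * z)); auto; [ring|].
  intros z Hz. eapply Cderiv_eq.
  + apply Cderiv_minus; [now apply HF|].
    apply Cderiv_mult; [apply Cderiv_const|apply Cderiv_id].
  + cbv beta. ring.
Qed.

(** Compactness of [[a, b]]. The displacement [k] is arbitrary in the plane, because a parameter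
    will push the path off itself; the radius must therefore also keep the displaced points in the
    disc. *)
Lemma uniform_cont_along_path (f : C -> C) (g : R -> C) (a b eps : R) :
  Ccont_disc f -> (forall t, (a <= t <= b)%R -> unit_disc (g t)) ->
  (forall t, path_cont g t) -> (0 < eps)%R ->
  exists d : R, (0 < d)%R /\ forall t k, (a <= t <= b)%R -> (Cmod k < d)%R ->
    unit_disc (g t + k) /\ (Cmod (f (g t + k)%C - f (g t)) <= eps)%R.
Proof.
intros Hf Hg Hc Heps.
assert (Hloc : forall t, exists d : posreal, (a <= t <= b)%R ->
  forall s k, (Rabs (s - t) < d)%R -> (Cmod k < d)%R ->
    unit_disc (g s + k) /\ (Cmod (f (g s + k)%C - f (g t)) <= eps / 2)%R).
{ intros t. destruct (classic (a <= t <= b)%R) as [Ht|Ht].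
  2:{ exists (mkposreal 1 Rlt_0_1). tauto. }
  destruct (disc_open (g t) (Hg t Ht)) as [d1 [Hd1 H1]].
  destruct (Hf (g t) (Hg t Ht) (eps / 2)%R) as [d2 [Hd2 H2]]; [lra|].
  (* Half the radius goes to the distance from [g t] to [g s], half to [k]. *)
  set (e := (Rmin d1 d2 / 2)%R).
  assert (He : (0 < e)%R) by (assert (H := Rmin_glb_lt _ _ _ Hd1 Hd2); unfold e; lra).
  destruct (Hc t e He) as [d3 [Hd3 H3]].
  assert (Hm : (0 < Rmin d3 e)%R) by now apply Rmin_glb_lt.
  exists (mkposreal _ Hm). simpl. intros _ s k Hs Hk.
  assert (Hs' : (Cmod (g s - g t) < e)%R).
  { specialize (H3 (s - t)%R (Rlt_le_trans _ _ _ Hs (Rmin_l _ _))).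
    now rewrite Rplus_minus in H3. }
  assert (Hk' := Rlt_le_trans _ _ _ Hk (Rmin_r _ _)).
  assert (Hsk : (Cmod ((g s - g t) + k) < 2 * e)%R).
  { eapply Rle_lt_trans; [apply Cmod_triangle|]. lra. }
  replace (g s + k) with (g t + ((g s - g t) + k)) by ring.
  assert (E : (2 * e = Rmin d1 d2)%R) by (unfold e; field). rewrite E in Hsk. split.
  - apply H1. eapply Rlt_le_trans; [exact Hsk|apply Rmin_l].
  - left. apply H2. eapply Rlt_le_trans; [exact Hsk|apply Rmin_r]. }
(* Choice makes a gauge out of the local radii, the form of data that the compactness theorem takes.
   Its conclusion is doubly negated, hence [NNPP] below. *)
set (delta := fun t => proj1_sig (constructive_indefinite_description _ (Hloc t))).
assert (Hdelta : forall t, (a <= t <= b)%R ->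
  forall s k, (Rabs (s - t) < delta t)%R -> (Cmod k < delta t)%R ->
    unit_disc (g s + k) /\ (Cmod (f (g s + k)%C - f (g t)) <= eps / 2)%R).
{ intros t. exact (proj2_sig (constructive_indefinite_description _ (Hloc t))). }
destruct (compactness_value_1d a b delta) as [d Hd].
exists d; split; [apply cond_pos|]. intros t k Ht Hk.
specialize (Hd t Ht). apply NNPP in Hd. destruct Hd as (s & Hs & Hts & Hds).
destruct (Hdelta s Hs t k Hts (Rlt_le_trans _ _ _ Hk Hds)) as [G1 G2].
assert (H0 : (Cmod 0 < delta s)%R) by (rewrite Cmod_0; apply cond_pos).
destruct (Hdelta s Hs t 0 Hts H0) as [_ G3]. rewrite Cplus_0_r in G3.
split; [exact G1|].
(* Both values are compared with the one at the point [s] whose interval contains [t]. *)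
replace (f (g t + k)%C - f (g t)) with ((f (g t + k)%C - f (g s)) - (f (g t) - f (g s))) by ring.
eapply Rle_trans; [apply Cmod_triangle_minus|]. lra.
Qed.

(** * Continuity and differentiation under the integral sign *)

Section ParametricIntegral.

(** The parameter [p] moves the path [g] in the direction [m], and [psi] is a weight. For a circle,
    [m = 1] translates it and [m = Cis] dilates it. Everything is done at [p = 0]; other points are
    reached by changing [g]. *)
Variables (f : C -> C) (g m psi : R -> C) (a b : R).
Hypothesis Hab : (a <= b)%R.
Hypothesis Hf : Ccont_disc f.
Hypothesis Hg : forall t, (a <= t <= b)%R -> unit_disc (g t).
Hypothesis Hgc : forall t, path_cont g t.
Hypothesis Hmc : forall t, path_cont m t.
Hypothesis Hpc : forall t, path_cont psi t.
Hypothesis Hm : forall t, (Cmod (m t) <= 1)%R.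
Hypothesis Hp : forall t, (Cmod (psi t) <= 1)%R.

Lemma path_cont_shift (F : C -> C) (p : C) (t : R) : Ccont F (g t + p * m t) ->
  path_cont (fun s => F (g s + p * m s) * psi s) t.
Proof.
intros HF. apply (path_cont_mult (fun s => F (g s + p * m s))); [|apply Hpc].
apply (path_cont_comp F); [exact HF|]. apply path_cont_plus; [apply Hgc|].
apply (path_cont_mult (fun _ => p)); [apply path_cont_const|apply Hmc].
Qed.

Lemma param_shift_small (d : R) (p : C) (t : R) : (Cmod p < d)%R -> (Cmod (p * m t) < d)%R.
Proof.
intros H. rewrite Cmod_mult. assert (H1 := Cmod_ge_0 p). specialize (Hm t). nra.
Qed.

Lemma param_integral_cont :
  Ccont (fun p => CInt (fun t => f (g t + p * m t) * psi t) a b) 0.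
Proof.
intros eps Heps.
assert (He : (0 < eps / (b - a + 1))%R) by (apply Rdiv_lt_0_compat; lra).
destruct (uniform_cont_along_path f g a b _ Hf Hg Hgc He) as [d [Hd H]].
assert (HI : forall p, (Cmod p < d)%R ->
  is_CInt (fun t => f (g t + p * m t) * psi t) a b (CInt (fun t => f (g t + p * m t) * psi t) a b)).
{ intros p Hpd. apply CInt_correct; [easy|]. intros t Ht. apply path_cont_shift, Hf.
  apply (H t); [easy|]. now apply param_shift_small. }
exists d; split; [easy|]. intros h Hh. rewrite Cplus_0_l.
assert (H0 : (Cmod 0 < d)%R) by now rewrite Cmod_0.
assert (HB := is_CInt_minus _ _ _ _ _ _ (HI h Hh) (HI 0 H0)).
eapply Rle_lt_trans.
- eapply (is_CInt_bound _ a b (eps / (b - a + 1)) _ Hab); [|exact HB].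
  intros t Ht. cbv beta. rewrite Cmult_0_l, Cplus_0_r.
  replace (f (g t + h * m t) * psi t - f (g t) * psi t) with
    ((f (g t + h * m t)%C - f (g t)) * psi t) by ring.
  rewrite Cmod_mult.
  destruct (H t (h * m t) Ht (param_shift_small d h t Hh)) as [_ H1].
  assert (H2 := Cmod_ge_0 (f (g t + h * m t)%C - f (g t))).
  assert (H3 := Cmod_ge_0 (psi t)). specialize (Hp t). nra.
- apply Rlt_le_trans with ((b - a + 1) * (eps / (b - a + 1)))%R; [nra|].
  right. field. lra.
Qed.

Lemma param_integral_deriv (F : C -> C) : (forall z, unit_disc z -> Cderiv F z (f z)) ->
  Cderiv (fun p => CInt (fun t => F (g t + p * m t) * psi t) a b) 0
    (CInt (fun t => f (g t) * m t * psi t) a b).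
Proof.
intros HF eps Heps.
assert (HFc : Ccont_disc F) by (intros z Hz; exact (Cderiv_Ccont _ _ _ (HF z Hz))).
(* Adding 1 to the length keeps the quotient meaningful when [a = b]. *)
assert (He : (0 < eps / (b - a + 1))%R) by (apply Rdiv_lt_0_compat; lra).
destruct (uniform_cont_along_path f g a b _ Hf Hg Hgc He) as [d [Hd H]].
assert (HI : forall p, (Cmod p < d)%R ->
  is_CInt (fun t => F (g t + p * m t) * psi t) a b (CInt (fun t => F (g t + p * m t) * psi t) a b)).
{ intros p Hpd. apply CInt_correct; [easy|]. intros t Ht. apply path_cont_shift, HFc.
  apply (H t); [easy|]. now apply param_shift_small. }
assert (HJ : is_CInt (fun t => f (g t) * m t * psi t) a b
               (CInt (fun t => f (g t) * m t * psi t) a b)).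
{ apply CInt_correct; [easy|]. intros t Ht.
  apply (path_cont_mult (fun s => f (g s) * m s)); [|apply Hpc].
  apply (path_cont_mult (fun s => f (g s))); [|apply Hmc].
  apply path_cont_comp; [now apply Hf, Hg|apply Hgc]. }
exists d; split; [easy|]. intros h Hh. rewrite Cplus_0_l.
assert (H0 : (Cmod 0 < d)%R) by now rewrite Cmod_0.
assert (HD := is_CInt_minus _ _ _ _ _ _
  (is_CInt_minus _ _ _ _ _ _ (HI h Hh) (HI 0 H0)) (is_CInt_mult _ _ _ h _ HJ)).
rewrite (Cmult_comm h) in HD.
eapply Rle_trans.
- eapply (is_CInt_bound _ a b (eps / (b - a + 1) * Cmod h) _ Hab); [|exact HD].
  intros t Ht. cbv beta. rewrite Cmult_0_l, Cplus_0_r.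
  replace (F (g t + h * m t) * psi t - F (g t) * psi t - h * (f (g t) * m t * psi t)) with
    ((F (g t + h * m t)%C - F (g t) - f (g t) * (g t + h * m t - g t)) * psi t) by ring.
  rewrite Cmod_mult.
  assert (Hs := param_shift_small d h t Hh).
  (* The remainder is estimated uniformly in [t]: on the segment from [g t] to the displaced point,
     [f] stays close to [f (g t)] by uniform continuity. *)
  assert (H1 : (Cmod (F (g t + h * m t)%C - F (g t) - f (g t) * (g t + h * m t - g t))
    <= eps / (b - a + 1) * Cmod (g t + h * m t - g t))%R).
  { apply (mean_value_ineq F f); auto; [now apply H|].
    intros s Hs1. rewrite <- (Cplus_minus (g t) (seg (g t) (g t + h * m t) s)).
    apply H; [easy|]. eapply Rle_lt_trans; [now apply seg_minus|].
    now rewrite Cplus_minus_l. }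
  rewrite (Cplus_minus_l (g t)) in H1 at 2.
  assert (H2 : (Cmod (h * m t) <= Cmod h)%R).
  { rewrite Cmod_mult. assert (H2 := Cmod_ge_0 h). specialize (Hm t). nra. }
  apply (Rmult_le_compat_l (eps / (b - a + 1))) in H2; [|lra].
  assert (H3 := Cmod_ge_0 (psi t)). assert (H4 := Cmod_ge_0
    (F (g t + h * m t)%C - F (g t) - f (g t) * (g t + h * m t - g t))). specialize (Hp t). nra.
- rewrite <- Rmult_assoc. apply Rmult_le_compat_r; [apply Cmod_ge_0|].
  apply Rle_trans with ((b - a + 1) * (eps / (b - a + 1)))%R; [nra|].
  right. field. lra.
Qed.

End ParametricIntegral.

Lemma Cderiv_translate (f : C -> C) (z l : C) :
  Cderiv (fun h => f (z + h)) 0 l -> Cderiv f z l.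
Proof.
intros H eps Heps. destruct (H eps Heps) as [d [Hd Hh]].
exists d; split; [easy|]. intros h Hhd. specialize (Hh h Hhd).
now rewrite Cplus_0_l, Cplus_0_r in Hh.
Qed.

Lemma Ccont_translate (f : C -> C) (z : C) : Ccont (fun h => f (z + h)) 0 -> Ccont f z.
Proof.
intros H eps Heps. destruct (H eps Heps) as [d [Hd Hh]].
exists d; split; [easy|]. intros h Hhd. specialize (Hh h Hhd).
now rewrite Cplus_0_l, Cplus_0_r in Hh.
Qed.

Lemma Ccont_ext_loc (f g : C -> C) (z : C) (d : R) : (0 < d)%R ->
  (forall h, (Cmod h < d)%R -> f (z + h) = g (z + h)) -> Ccont f z -> Ccont g z.
Proof.
intros Hd Heq H eps Heps. destruct (H eps Heps) as [d' [Hd' H']].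
exists (Rmin d d'); split; [now apply Rmin_glb_lt|].
intros h Hh.
rewrite <- Heq by (eapply Rlt_le_trans; [exact Hh|apply Rmin_l]).
assert (E : g z = f z).
{ replace z with (z + 0) by ring. rewrite Heq; [easy|]. now rewrite Cmod_0. }
rewrite E. apply H'. eapply Rlt_le_trans; [exact Hh|apply Rmin_r].
Qed.

Lemma two_PI_pos : (0 < 2 * PI)%R.
Proof. assert (H := PI_RGT_0). lra. Qed.

Lemma circle_disc (w h : C) (t : R) : (Cmod w + Cmod h < 1)%R -> unit_disc (w + h * Cis t).
Proof.
intros H. unfold unit_disc. eapply Rle_lt_trans; [apply Cmod_triangle|].
now rewrite Cmod_mult, Cmod_Cis, Rmult_1_r.
Qed.

Lemma path_cont_circle (f : C -> C) (w h : C) (t : R) : Ccont_disc f ->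
  (Cmod w + Cmod h < 1)%R -> path_cont (fun s => f (w + h * Cis s)) t.
Proof.
intros Hf H. apply (path_cont_comp f); [now apply Hf, circle_disc|].
apply path_cont_plus; [apply path_cont_const|].
apply (path_cont_mult (fun _ => h)); [apply path_cont_const|apply path_cont_Cis].
Qed.

Lemma CInt_ext (f g : R -> C) (a b : R) : (forall t, f t = g t) -> CInt f a b = CInt g a b.
Proof.
intros H. apply (RInt_ext (V := C_R_CompleteNormedModule)). intros; apply H.
Qed.

(** * Mean values over circles and an integral formula for a continuous derivative *)

Section MeanValue.

Variables F f : C -> C.
Hypothesis HF : forall z, unit_disc z -> Cderiv F z (f z).
Hypothesis Hf : Ccont_disc f.

Let HFc : Ccont_disc F.
Proof. intros z Hz. exact (Cderiv_Ccont _ _ _ (HF z Hz)). Qed.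

Lemma circle_by_parts (w h : C) : (Cmod w + Cmod h < 1)%R ->
  CInt (fun t => F (w + h * Cis t) * Cis_inv t) 0 (2 * PI) =
  h * CInt (fun t => f (w + h * Cis t)) 0 (2 * PI).
Proof.
intros H. assert (HP := two_PI_pos).
assert (HI1 : is_CInt (fun t => F (w + h * Cis t) * Cis_inv t) 0 (2 * PI)
  (CInt (fun t => F (w + h * Cis t) * Cis_inv t) 0 (2 * PI))).
{ apply CInt_correct; [lra|]. intros t _.
  apply (path_cont_mult (fun s => F (w + h * Cis s)));
    [now apply path_cont_circle|apply path_cont_Cis_inv]. }
assert (HI2 : is_CInt (fun t => f (w + h * Cis t)) 0 (2 * PI)
  (CInt (fun t => f (w + h * Cis t)) 0 (2 * PI))).
{ apply CInt_correct; [lra|]. intros t _. now apply path_cont_circle. }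
(* The product [F (w + h e^{it}) e^{-it}] is differentiated in [t]; since it is periodic, its total
   increment vanishes, which is the relation sought up to the factor [Ci]. *)
assert (HD : is_CInt (fun t => Ci * (h * f (w + h * Cis t) - F (w + h * Cis t) * Cis_inv t))
  0 (2 * PI) (F (w + h * Cis (2 * PI)) * Cis_inv (2 * PI) - F (w + h * Cis 0) * Cis_inv 0)).
{ apply (is_CInt_deriv (fun t => F (w + h * Cis t) * Cis_inv t)); [lra| |]; intros t _.
  - eapply path_deriv_eq.
    + apply (path_deriv_mult (fun s => F (w + h * Cis s)));
        [|apply path_deriv_Cis_inv].
      apply path_deriv_comp; [now apply HF, circle_disc|].
      apply (path_deriv_comp (fun z => w + h * z)); [|apply path_deriv_Cis].
      apply Cderiv_plus; [apply Cderiv_const|].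
      apply Cderiv_mult; [apply Cderiv_const|apply Cderiv_id].
    + cbv beta.
      transitivity (Ci * (h * f (w + h * Cis t) * (Cis t * Cis_inv t) -
        F (w + h * Cis t) * Cis_inv t)); [ring|].
      rewrite Cis_Cis_inv. ring.
  - apply (path_cont_mult (fun _ => Ci)); [apply path_cont_const|].
    apply (path_cont_plus (fun s => h * f (w + h * Cis s))).
    + apply (path_cont_mult (fun _ => h)); [apply path_cont_const|now apply path_cont_circle].
    + apply (path_cont_comp Copp (fun s => F (w + h * Cis s) * Cis_inv s)).
      * eapply (Cderiv_Ccont _ _ (-(1))).
        apply (Cderiv_ext_loc (fun z => 0 - z) _ _ _ 1); [lra|intros; ring|].
        eapply Cderiv_eq; [apply Cderiv_minus; [apply Cderiv_const|apply Cderiv_id]|ring].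
      * apply (path_cont_mult (fun s => F (w + h * Cis s)));
          [now apply path_cont_circle|apply path_cont_Cis_inv]. }
assert (HD2 := is_CInt_mult _ _ _ Ci _
  (is_CInt_minus _ _ _ _ _ _ (is_CInt_mult _ _ _ h _ HI2) HI1)).
apply is_CInt_unique in HD. apply is_CInt_unique in HD2. cbv beta in HD2.
rewrite HD in HD2. clear HD.
assert (E1 : Cis (2 * PI) = Cis 0) by (unfold Cis; now rewrite cos_2PI, sin_2PI, cos_0, sin_0).
assert (E2 : Cis_inv (2 * PI) = Cis_inv 0)
  by (unfold Cis_inv; now rewrite cos_2PI, sin_2PI, cos_0, sin_0).
rewrite E1, E2 in HD2.
set (A := CInt (fun t => f (w + h * Cis t)) 0 (2 * PI)) in *.
set (B := CInt (fun t => F (w + h * Cis t) * Cis_inv t) 0 (2 * PI)) in *.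
assert (E : Ci * (h * A - B) = 0) by (rewrite <- HD2; ring).
symmetry. apply Ceq_minus.
transitivity (/ Ci * (Ci * (h * A - B))); [field; apply Ci_nz|rewrite E; ring].
Qed.

Lemma circle_deriv (w h : C) : (Cmod w + Cmod h < 1)%R ->
  Cderiv (fun p => CInt (fun t => F (w + p * Cis t) * Cis_inv t) 0 (2 * PI)) h
    (CInt (fun t => f (w + h * Cis t)) 0 (2 * PI)).
Proof.
intros H. assert (HP := two_PI_pos). apply Cderiv_translate.
apply (Cderiv_ext_loc (fun p => CInt (fun t => F (w + h * Cis t + p * Cis t) * Cis_inv t) 0 (2 * PI))
  _ _ _ 1); [lra| |].
- intros p _. apply CInt_ext. intros t.
  now replace (w + h * Cis t + (0 + p) * Cis t) with (w + (h + (0 + p)) * Cis t) by ring.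
(* The factor [Cis t * Cis_inv t = 1] is inserted to give the integrand the shape with direction
   [Cis] and weight [Cis_inv]. *)
- rewrite (CInt_ext (fun t => f (w + h * Cis t)) (fun t => f (w + h * Cis t) * Cis t * Cis_inv t)).
  2:{ intros t. rewrite <- Cmult_assoc, Cis_Cis_inv. ring. }
  apply (param_integral_deriv f (fun t => w + h * Cis t) Cis Cis_inv); auto; try lra.
  + intros t _. now apply circle_disc.
  + intros t. apply path_cont_plus; [apply path_cont_const|].
    apply (path_cont_mult (fun _ => h)); [apply path_cont_const|apply path_cont_Cis].
  + apply path_cont_Cis.
  + apply path_cont_Cis_inv.
  + intros t. rewrite Cmod_Cis. lra.
  + intros t. rewrite Cmod_Cis_inv. lra.
Qed.

(* As h B'(h) = B(h), the quotient B(h)/h = B'(h) has derivative 0 along rays,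
   where B(h) is the left-hand side of [circle_by_parts]. *)
Lemma circle_mean_ray (w : C) (r s0 : R) : (0 < r)%R -> (Cmod w + r < 1)%R ->
  (0 < s0 <= 1)%R ->
  CInt (fun t => f (w + r * Cis t)) 0 (2 * PI) =
  CInt (fun t => f (w + (s0 * r)%R * Cis t)) 0 (2 * PI).
Proof.
intros Hr Hwr Hs0.
set (A := fun h => CInt (fun t => f (w + h * Cis t)) 0 (2 * PI)).
set (B := fun h => CInt (fun t => F (w + h * Cis t) * Cis_inv t) 0 (2 * PI)).
assert (Hin : forall s, (s0 <= s <= 1)%R -> (Cmod w + Cmod (RtoC s * r) < 1)%R).
{ intros s Hs. rewrite Cmod_mult, !Cmod_R, !Rabs_pos_eq by lra. nra. }
assert (HBA : forall s, (s0 <= s <= 1)%R -> B (RtoC s * r) = RtoC s * r * A (RtoC s * r)).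
{ intros s Hs. now apply circle_by_parts, Hin. }
assert (Hnz : forall s, (s0 <= s <= 1)%R -> RtoC s <> 0).
{ intros s Hs E. apply RtoC_inj in E. lra. }
assert (H : is_CInt (fun _ => 0) s0 1 (B (RtoC 1 * r) * / RtoC 1 - B (RtoC s0 * r) * / RtoC s0)).
{ apply (is_CInt_deriv (fun s => B (RtoC s * r) * / RtoC s)); [lra| |]; intros s Hs;
    [|apply path_cont_const].
  assert (Hid : path_deriv RtoC s 1).
  { intros eps Heps. exists 1%R; split; [lra|]. intros h _.
    replace (RtoC (s + h) - s - 1 * h) with (RtoC 0) by (rewrite RtoC_plus; ring).
    rewrite Cmod_0. apply Rmult_le_pos; [lra|apply Rabs_pos]. }
  eapply path_deriv_eq.
  - apply (path_deriv_mult (fun s => B (RtoC s * r)) (fun s => / RtoC s)).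
    + apply (path_deriv_comp B (fun s => RtoC s * r)).
      * apply circle_deriv. now apply Hin.
      * apply (path_deriv_comp (fun z => z * r)); [|exact Hid].
        apply Cderiv_mult; [apply Cderiv_id|apply Cderiv_const].
    + apply (path_deriv_comp Cinv RtoC); [|exact Hid].
      apply Cderiv_inv. now apply Hnz.
  - cbv beta. rewrite HBA by easy. fold (A (RtoC s * r)). field. now apply Hnz. }
assert (H0 := is_CInt_bound _ s0 1 0 _ (proj2 Hs0) (fun t _ => Req_le _ _ Cmod_0) H).
rewrite Rmult_0_r in H0.
assert (E := Cmod_eq_0 _ (Rle_antisym _ _ H0 (Cmod_ge_0 _))).
rewrite !HBA in E by lra.
assert (Hrn : RtoC r <> 0) by (intros E'; apply RtoC_inj in E'; lra).
assert (Hsn := Hnz s0 ltac:(lra)).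
change (A r = A (s0 * r)%R). rewrite RtoC_mult.
apply Ceq_minus.
transitivity (/ r * (RtoC 1 * r * A (RtoC 1 * r) * / RtoC 1 - s0 * r * A (s0 * r) * / s0));
  [|rewrite E; ring].
rewrite Cmult_1_l. field. auto.
Qed.

(** The integral is the same for all smaller positive radii on the ray, and it is continuous at
    radius 0, where the integrand is the constant [f w]. *)
Lemma circle_mean (w : C) (r : R) : (0 < r)%R -> (Cmod w + r < 1)%R ->
  CInt (fun t => f (w + r * Cis t)) 0 (2 * PI) = (2 * PI)%R * f w.
Proof.
intros Hr Hwr. assert (HP := two_PI_pos).
set (A := fun h => CInt (fun t => f (w + h * Cis t)) 0 (2 * PI)).
assert (HAc : Ccont A 0).
{ apply (Ccont_ext_loc (fun p => CInt (fun t => f (w + p * Cis t) * 1) 0 (2 * PI)) _ _ 1); [lra| |].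
  - intros h _. apply CInt_ext. intros t. ring.
  - apply (param_integral_cont f (fun _ => w) Cis (fun _ => 1)); auto; try lra.
    + intros t _. unfold unit_disc. lra.
    + intros t. apply path_cont_const.
    + apply path_cont_Cis.
    + intros t. apply path_cont_const.
    + intros t. rewrite Cmod_Cis. lra.
    + intros t. rewrite Cmod_1. lra. }
assert (HA0 : A 0 = (2 * PI)%R * f w).
{ apply is_CInt_unique.
  apply (is_CInt_ext (fun _ => f w)); [lra| |].
  - intros t _. f_equal. ring.
  - assert (H : is_CInt (fun _ => f w) 0 (2 * PI) (f w * (2 * PI)%R - f w * 0%R)).
    { apply (is_CInt_deriv (fun t => f w * RtoC t)); [lra| |]; intros t _;
        [|apply path_cont_const].
      intros eps Heps. exists 1%R; split; [lra|]. intros h _.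
      replace (f w * RtoC (t + h) - f w * t - f w * h) with (RtoC 0)
        by (rewrite RtoC_plus; ring).
      rewrite Cmod_0. apply Rmult_le_pos; [lra|apply Rabs_pos]. }
    replace ((2 * PI)%R * f w) with (f w * (2 * PI)%R - f w * 0%R) by ring. exact H. }
rewrite <- HA0. change (A r = A 0).
apply Ceq_minus, Cmod_eq_0, Rle_antisym; [|apply Cmod_ge_0].
apply le_epsilon. intros eps Heps. rewrite Rplus_0_l.
destruct (HAc eps Heps) as [d [Hd H]].
(* Puts the radius [s0 * r] at most at [d / 2], inside the range of continuity, without leaving
   [0 < s0 <= 1]. *)
set (s0 := Rmin 1 (d / (2 * r))).
assert (Hs0 : (0 < s0 <= 1)%R).
{ split; [apply Rmin_glb_lt; [lra|apply Rdiv_lt_0_compat; lra]|apply Rmin_l]. }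
assert (Hs0d : (s0 * r < d)%R).
{ apply Rle_lt_trans with (d / (2 * r) * r)%R.
  - apply Rmult_le_compat_r; [lra|apply Rmin_r].
  - replace (d / (2 * r) * r)%R with (d / 2)%R by (field; lra). lra. }
unfold A at 1. rewrite (circle_mean_ray w r s0 Hr Hwr Hs0).
left. specialize (H (s0 * r)%R). rewrite Cplus_0_l in H. apply H.
rewrite Cmod_R, Rabs_pos_eq; [easy|]. apply Rmult_le_pos; lra.
Qed.

Lemma cauchy_formula_deriv (w : C) (r : R) : (0 < r)%R -> (Cmod w + r < 1)%R ->
  f w = / (2 * PI * r)%R * CInt (fun t => F (w + r * Cis t) * Cis_inv t) 0 (2 * PI).
Proof.
intros Hr Hwr. assert (HP := two_PI_pos).
rewrite circle_by_parts, circle_mean by (rewrite ?Cmod_R, ?Rabs_pos_eq by lra; lra).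
rewrite (RtoC_mult (2 * PI) r).
assert (H1 : RtoC (2 * PI) <> 0) by (intros E; apply RtoC_inj in E; lra).
assert (H2 : RtoC r <> 0) by (intros E; apply RtoC_inj in E; lra).
field. auto.
Qed.

(** In this section [f] is only a continuous derivative; its differentiability is the outcome. A
    displacement of [w] translates the circle inside [F], so the derivative in [w] replaces [F] by
    [f] under the integral. *)
Lemma deriv_cauchy_formula (w : C) (r : R) : (0 < r)%R -> (Cmod w + r < 1)%R ->
  Cderiv f w (/ (2 * PI * r)%R * CInt (fun t => f (w + r * Cis t) * Cis_inv t) 0 (2 * PI)).
Proof.
intros Hr Hwr. assert (HP := two_PI_pos).
apply Cderiv_translate.
apply (Cderiv_ext_loc (fun h => / (2 * PI * r)%R *
  CInt (fun t => F (w + r * Cis t + h * 1) * Cis_inv t) 0 (2 * PI)) _ _ _ (1 - r - Cmod w)); [lra| |].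
- intros h Hh. rewrite Cplus_0_l. rewrite (cauchy_formula_deriv (w + h) r Hr).
  + f_equal. apply CInt_ext. intros t.
    now replace (w + h + r * Cis t) with (w + r * Cis t + h * 1) by ring.
  + assert (H := Cmod_triangle w h). lra.
- eapply Cderiv_eq.
  + apply (Cderiv_mult (fun _ => / (2 * PI * r)%R)); [apply Cderiv_const|].
    apply (param_integral_deriv f (fun t => w + r * Cis t) (fun _ => 1) Cis_inv); auto; try lra.
    * intros t _. apply circle_disc. rewrite Cmod_R, Rabs_pos_eq; lra.
    * intros t. apply path_cont_plus; [apply path_cont_const|].
      apply (path_cont_mult (fun _ => RtoC r)); [apply path_cont_const|apply path_cont_Cis].
    * intros t. apply path_cont_const.
    * apply path_cont_Cis_inv.
    * intros t. rewrite Cmod_1. lra.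
    * intros t. rewrite Cmod_Cis_inv. lra.
  + cbv beta. rewrite Cmult_0_l, Cplus_0_l. f_equal. apply CInt_ext. intros t. ring.
Qed.

Lemma deriv_cont (df : C -> C) : (forall z, unit_disc z -> Cderiv f z (df z)) ->
  Ccont_disc df.
Proof.
intros Hdf w Hw. assert (HP := two_PI_pos). unfold unit_disc in Hw.
(* Half the distance to the unit circle: one radius then serves every centre [w + h] with
   [|h| < r]. *)
set (r := ((1 - Cmod w) / 2)%R). assert (Hr : (0 < r)%R) by (unfold r; lra).
assert (Hr1 : (Cmod w + r = 1 - r)%R) by (unfold r; field).
apply Ccont_translate.
apply (Ccont_ext_loc (fun h => / (2 * PI * r)%R *
  CInt (fun t => f (w + r * Cis t + h * 1) * Cis_inv t) 0 (2 * PI)) _ _ r); [lra| |].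
- intros h Hh. rewrite Cplus_0_l.
  assert (Hwh : (Cmod (w + h) + r < 1)%R) by (assert (H := Cmod_triangle w h); lra).
  assert (H1 := Cderiv_C_derive _ _ _ (deriv_cauchy_formula (w + h) r Hr Hwh)).
  assert (H2 := Cderiv_C_derive _ _ _ (Hdf (w + h) ltac:(unfold unit_disc; lra))).
  rewrite <- H2, H1. f_equal. apply CInt_ext. intros t.
  now replace (w + h + r * Cis t) with (w + r * Cis t + h * 1) by ring.
- assert (H : Ccont (fun h => CInt (fun t => f (w + r * Cis t + h * 1) * Cis_inv t) 0 (2 * PI)) 0).
  { apply (param_integral_cont f (fun t => w + r * Cis t) (fun _ => 1) Cis_inv); auto; try lra.
    * intros t _. apply circle_disc. rewrite Cmod_R, Rabs_pos_eq; lra.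
    * intros t. apply path_cont_plus; [apply path_cont_const|].
      apply (path_cont_mult (fun _ => RtoC r)); [apply path_cont_const|apply path_cont_Cis].
    * intros t. apply path_cont_const.
    * apply path_cont_Cis_inv.
    * intros t. rewrite Cmod_1. lra.
    * intros t. rewrite Cmod_Cis_inv. lra. }
  set (c := / RtoC (2 * PI * r)).
  intros eps Heps. assert (Hc := Cmod_ge_0 c).
  destruct (H (eps / (1 + Cmod c))%R) as [d [Hd H1]]; [apply Rdiv_lt_0_compat; lra|].
  exists d; split; [easy|]. intros h Hh. specialize (H1 h Hh).
  match goal with |- (Cmod (c * ?u - c * ?v) < _)%R =>
    replace (c * u - c * v) with (c * (u - v)) by ring; set (x := u - v) in * end.
  rewrite Cmod_mult.
  apply (Rmult_lt_compat_l (1 + Cmod c)) in H1; [|lra].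
  replace ((1 + Cmod c) * (eps / (1 + Cmod c)))%R with eps in H1 by (field; lra).
  assert (H2 := Cmod_ge_0 x). lra.
Qed.

End MeanValue.

Lemma Cderiv_disc_deriv (f df : C -> C) : (forall z, unit_disc z -> Cderiv f z (df z)) ->
  forall z, unit_disc z -> Cderiv df z (C_derive df z).
Proof.
intros Hdf w Hw.
destruct (disc_primitive f df Hdf) as [F HF].
assert (Hf : Ccont_disc f) by (intros z Hz; exact (Cderiv_Ccont _ _ _ (Hdf z Hz))).
assert (Hdfc := deriv_cont F f HF Hf df Hdf). unfold unit_disc in Hw.
assert (H := deriv_cauchy_formula f df Hdf Hdfc w ((1 - Cmod w) / 2) ltac:(lra) ltac:(lra)).
now rewrite (Cderiv_C_derive _ _ _ H).
Qed.

Lemma holomorphic_C_derive (f : C -> C) : holomorphic f -> holomorphic (C_derive f).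
Proof.
intros Hf z Hz.
assert (Hd : forall z, unit_disc z -> Cderiv f z (C_derive f z))
  by (intros w Hw; now apply holomorphic_Cderiv, Hf).
exact (Cderiv_ex_derive _ _ _ (Cderiv_disc_deriv f (C_derive f) Hd z Hz)).
Qed.

(** * Exponential and logarithm *)

Definition Cexp (z : C) : C := RtoC (exp (fst z)) * Cis (snd z).

Lemma Cexp_plus (z w : C) : Cexp (z + w) = Cexp z * Cexp w.
Proof.
unfold Cexp. simpl. rewrite exp_plus, RtoC_mult.
replace (Cis (snd z + snd w)) with (Cis (snd z) * Cis (snd w)); [ring|].
unfold Cis, Cmult; simpl. rewrite cos_plus, sin_plus. f_equal; ring.
Qed.

Lemma Cexp_0 : Cexp 0 = 1.
Proof. unfold Cexp, Cis; simpl. rewrite exp_0, cos_0, sin_0. change (1 * 1 = 1). ring. Qed.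

Lemma Cexp_neq0 (z : C) : Cexp z <> 0.
Proof.
apply Cmod_gt_0. unfold Cexp. rewrite Cmod_mult, Cmod_Cis, Cmod_R, Rmult_1_r.
apply Rabs_pos_lt. assert (H := exp_pos (fst z)). lra.
Qed.

Lemma Cderiv_Cexp_0 : Cderiv Cexp 0 1.
Proof.
intros eps Heps.
(* The three error terms are at most [e |a|], [e |b|] and [2 e |b|], together [4 e |h|], whence
   [eps / 4]. *)
set (e := Rmin 1 (eps / 4)).
assert (He : (0 < e)%R) by (apply Rmin_glb_lt; lra).
assert (He1 : (e <= 1)%R) by apply Rmin_l. assert (He4 : (e <= eps / 4)%R) by apply Rmin_r.
assert (Hexp : path_deriv (fun t => RtoC (exp t)) 0 1).
{ eapply path_deriv_eq.
  - apply (path_deriv_pair exp (fun _ => 0%R)); [apply is_derive_exp|].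
    apply (is_derive_const (K := R_AbsRing) (V := R_NormedModule)).
  - now rewrite exp_0. }
destruct (Hexp e He) as [d1 [Hd1 H1]].
destruct (path_deriv_cont _ _ _ Hexp e He) as [d2 [Hd2 H2]].
destruct (path_deriv_Cis 0 e He) as [d3 [Hd3 H3]].
exists (Rmin d1 (Rmin d2 d3)); split; [repeat apply Rmin_glb_lt; easy|].
intros [a b] Hh.
assert (Hh' := Rlt_le_trans _ _ _ Hh (Rmin_r _ _)).
assert (Ha : (Rabs a <= Cmod (a, b))%R)
  by (eapply Rle_trans; [|apply Rmax_Cmod]; apply (Rmax_l (Rabs a))).
assert (Hb : (Rabs b <= Cmod (a, b))%R)
  by (eapply Rle_trans; [|apply Rmax_Cmod]; apply (Rmax_r _ (Rabs b))).
specialize (H1 a (Rle_lt_trans _ _ _ Ha (Rlt_le_trans _ _ _ Hh (Rmin_l _ _)))).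
specialize (H2 a (Rle_lt_trans _ _ _ Ha (Rlt_le_trans _ _ _ Hh' (Rmin_l _ _)))).
specialize (H3 b (Rle_lt_trans _ _ _ Hb (Rlt_le_trans _ _ _ Hh' (Rmin_r _ _)))).
rewrite Rplus_0_l in *. rewrite exp_0 in *.
assert (E0 : Cis 0 = 1) by (unfold Cis; now rewrite cos_0, sin_0).
rewrite E0 in H3. rewrite Cplus_0_l, Cexp_0.
unfold Cexp. cbn [fst snd].
set (p := RtoC (exp a)) in *. set (q := Cis b) in *.
(* The increment of a product is the sum of the two increments plus their product, which is of
   second order. *)
replace (p * q - 1 - 1 * (a, b)) with
  ((p - 1 - 1 * a) + ((q - 1 - Ci * 1 * b) + (p - 1) * (q - 1))).
2:{ replace (a, b) with (RtoC a + Ci * b)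
      by (unfold RtoC, Ci, Cplus, Cmult; simpl; f_equal; ring). ring. }
assert (H4 : (Cmod (q - 1) <= 2 * Rabs b)%R).
{ replace (q - 1) with ((q - 1 - Ci * 1 * b) + Ci * b) by ring.
  eapply Rle_trans; [apply Cmod_triangle|].
  rewrite Cmod_mult, Cmod_Ci, Cmod_R. assert (H4 := Rabs_pos b). nra. }
eapply Rle_trans; [apply Cmod_triangle|].
eapply Rle_trans; [apply Rplus_le_compat_l, Cmod_triangle|].
rewrite (Cmod_mult (p - 1)).
assert (H5 : (Cmod (p - 1) * Cmod (q - 1) <= e * (2 * Rabs b))%R)
  by (apply Rmult_le_compat; try apply Cmod_ge_0; lra).
assert (H6 := Cmod_ge_0 (a, b)). nra.
Qed.

Lemma Cderiv_Cexp (z : C) : Cderiv Cexp z (Cexp z).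
Proof.
apply Cderiv_translate.
apply (Cderiv_ext_loc (fun h => Cexp z * Cexp h) _ _ _ 1); [lra| |].
- intros h _. now rewrite Cplus_0_l, Cexp_plus.
- eapply Cderiv_eq; [apply Cderiv_mult; [apply Cderiv_const|apply Cderiv_Cexp_0]|cbv beta; ring].
Qed.

Lemma Cis_surj (x y : R) : (x * x + y * y = 1)%R -> exists t, Cis t = (x, y).
Proof.
intros H. assert (Hx : (-1 <= x <= 1)%R) by nra.
assert (Hs : sqrt (1 - x²) = Rabs y).
{ replace (1 - x²)%R with (y²) by (unfold Rsqr; lra). apply sqrt_Rsqr_abs. }
unfold Cis. destruct (Rle_or_lt 0 y) as [Hy|Hy].
- exists (acos x). rewrite cos_acos, sin_acos, Hs, Rabs_pos_eq; easy.
- exists (- acos x)%R. rewrite cos_neg, sin_neg, cos_acos, sin_acos, Hs, Rabs_left by easy.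
  f_equal. ring.
Qed.

Lemma Cexp_surj (c : C) : c <> 0 -> exists u, Cexp u = c.
Proof.
intros Hc. assert (Hm := proj1 (Cmod_gt_0 c) Hc).
assert (Hsq := Cmod2_alt c). unfold Re, Im in Hsq.
destruct (Cis_surj (fst c / Cmod c) (snd c / Cmod c)) as [t Ht].
{ replace (fst c / Cmod c * (fst c / Cmod c) + snd c / Cmod c * (snd c / Cmod c))%R
    with ((fst c ^ 2 + snd c ^ 2) / Cmod c ^ 2)%R by (field; lra).
  rewrite <- Hsq. field. lra. }
exists (ln (Cmod c), t). unfold Cexp. simpl. rewrite exp_ln, Ht by easy.
destruct c as [x y]; simpl in *. unfold Cmult, RtoC; simpl. f_equal; field; lra.
Qed.

(** If [G] is a primitive of [s' / s], then [s exp (- G)] has derivative 0 and equals a constant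
    [exp u], so [u + G] is a logarithm. That [s' / s] has a primitive rests on the differentiability
    of [s']. *)
Lemma disc_log (s ds : C -> C) : (forall z, unit_disc z -> Cderiv s z (ds z)) ->
  (forall z, unit_disc z -> s z <> 0) ->
  exists L dL : C -> C, (forall z, unit_disc z -> Cderiv L z (dL z)) /\
    forall z, unit_disc z -> s z = Cexp (L z).
Proof.
intros Hs Hnz. assert (Hds := Cderiv_disc_deriv s ds Hs).
destruct (disc_primitive (fun z => ds z * / s z)
  (fun z => C_derive ds z * / s z + ds z * (ds z * - / (s z * s z)))) as [G HG].
{ intros z Hz. apply (Cderiv_mult ds (fun w => / s w)); [now apply Hds|].
  apply (Cderiv_comp Cinv s); [apply Cderiv_inv|]; auto. }
set (K := fun z => s z * Cexp (0 - G z)).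
assert (HK : forall z, unit_disc z -> Cderiv K z 0).
{ intros z Hz. eapply Cderiv_eq.
  - apply Cderiv_mult; [now apply Hs|].
    apply (Cderiv_comp Cexp (fun w => 0 - G w)); [apply Cderiv_Cexp|].
    apply Cderiv_minus; [apply Cderiv_const|now apply HG].
  - cbv beta. field. auto. }
assert (H0 : unit_disc 0) by (unfold unit_disc; rewrite Cmod_0; lra).
assert (HK0 : forall z, unit_disc z -> K z = K 0).
{ intros z Hz.
  assert (H := mean_value_ineq K (fun _ => 0) 0 z 0 0 HK (fun w _ => Ccont_const 0 w) H0 Hz).
  apply Ceq_minus, Cmod_eq_0, Rle_antisym; [|apply Cmod_ge_0].
  replace (K z - K 0) with (K z - K 0 - 0 * (z - 0)) by ring.
  rewrite Rmult_0_l in H. apply H.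
  intros t _. replace (0 - 0) with (RtoC 0) by ring. rewrite Cmod_0. lra. }
destruct (Cexp_surj (K 0)) as [u Hu].
{ unfold K. apply Cmult_neq_0; [auto|apply Cexp_neq0]. }
exists (fun z => u + G z), (fun z => 0 + ds z * / s z). split.
- intros z Hz. apply Cderiv_plus; [apply Cderiv_const|now apply HG].
- intros z Hz. rewrite Cexp_plus, Hu, <- (HK0 z Hz). unfold K.
  transitivity (s z * Cexp (0 - G z + G z)); [|rewrite Cexp_plus; ring].
  replace (0 - G z + G z) with (RtoC 0) by ring. rewrite Cexp_0. ring.
Qed.

Lemma disc_inv_cube_root (s ds : C -> C) : (forall z, unit_disc z -> Cderiv s z (ds z)) ->
  (forall z, unit_disc z -> s z <> 0) ->
  exists lam : C -> C, holomorphic lam /\ (forall z, unit_disc z -> lam z <> 0) /\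
    forall z, unit_disc z -> lam z ^ 3 * s z = 1.
Proof.
intros Hs Hnz. destruct (disc_log s ds Hs Hnz) as (L & dL & HL & HsL).
exists (fun z => Cexp (- / 3 * L z)). repeat split.
- intros z Hz. eapply Cderiv_ex_derive.
  apply (Cderiv_comp Cexp (fun w => - / 3 * L w)); [apply Cderiv_Cexp|].
  apply Cderiv_mult; [apply Cderiv_const|now apply HL].
- intros z _. apply Cexp_neq0.
- intros z Hz. rewrite (HsL z Hz). set (a := - / 3 * L z).
  replace (Cexp a ^ 3) with (Cexp a * (Cexp a * Cexp a)) by (simpl; ring).
  rewrite <- !Cexp_plus.
  replace (a + (a + a) + L z) with (RtoC 0) by (unfold a; field). apply Cexp_0.
Qed.

(** * Curvatures *)

Lemma holomorphic_Cderiv_n (f : C -> C) (n : nat) : holomorphic f ->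
  forall z, unit_disc z -> Cderiv (C_derive_n f n) z (C_derive_n f (S n) z).
Proof.
intros Hf z Hz. apply holomorphic_Cderiv.
revert z Hz. change (holomorphic (C_derive_n f n)).
induction n as [|n IH]; [exact Hf|now apply holomorphic_C_derive].
Qed.

Lemma Cderiv_ext_disc (f g : C -> C) (z l : C) : unit_disc z ->
  (forall w, unit_disc w -> f w = g w) -> Cderiv f z l -> Cderiv g z l.
Proof.
intros Hz H. destruct (disc_open z Hz) as [d [Hd Hdisc]].
apply (Cderiv_ext_loc f g z l d Hd). intros h Hh. now apply H, Hdisc.
Qed.

(** Identities hold on the disc only, while [C_derive_n] acts on total functions. Since the disc is
    open, agreement passes to every derivative. *)
Lemma C_derive_n_ext_disc (f g : C -> C) (n : nat) : holomorphic f ->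
  (forall z, unit_disc z -> f z = g z) ->
  forall z, unit_disc z -> C_derive_n f n z = C_derive_n g n z.
Proof.
intros Hf H. induction n as [|n IH]; [exact H|]. intros z Hz.
symmetry. apply Cderiv_C_derive.
apply (Cderiv_ext_disc (C_derive_n f n)); auto. now apply holomorphic_Cderiv_n.
Qed.

(** The device for differentiating an identity valid on the disc: the derivative of its left side
    must vanish. *)
Lemma Cderiv_disc_const (f : C -> C) (c z l : C) : unit_disc z ->
  (forall w, unit_disc w -> f w = c) -> Cderiv f z l -> l = 0.
Proof.
intros Hz H Hf.
rewrite <- (Cderiv_C_derive _ _ _ (Cderiv_ext_disc f (fun _ => c) z l Hz H Hf)).
apply Cderiv_C_derive, Cderiv_const.
Qed.

Lemma C_derive_n_mult (F u v : C -> C) : holomorphic u -> holomorphic v ->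
  (forall z, unit_disc z -> F z = u z * v z) ->
  forall z, unit_disc z ->
  let u := fun n => C_derive_n u n z in
  let v := fun n => C_derive_n v n z in
  C_derive_n F 1 z = u 1%nat * v 0%nat + u 0%nat * v 1%nat /\
  C_derive_n F 2 z = u 2%nat * v 0%nat + 2 * u 1%nat * v 1%nat + u 0%nat * v 2%nat /\
  C_derive_n F 3 z = u 3%nat * v 0%nat + 3 * u 2%nat * v 1%nat + 3 * u 1%nat * v 2%nat
    + u 0%nat * v 3%nat.
Proof.
intros Hu Hv HF.
assert (Du := fun n => holomorphic_Cderiv_n u n Hu).
assert (Dv := fun n => holomorphic_Cderiv_n v n Hv).
assert (Dm : forall i j z, unit_disc z ->
  Cderiv (fun w => C_derive_n u i w * C_derive_n v j w) z
    (C_derive_n u (S i) z * C_derive_n v j z + C_derive_n u i z * C_derive_n v (S j) z))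
  by (intros i j z Hz; apply Cderiv_mult; auto).
assert (H1 : forall z, unit_disc z -> C_derive_n u 1 z * C_derive_n v 0 z
    + C_derive_n u 0 z * C_derive_n v 1 z = C_derive_n F 1 z).
{ intros z Hz. symmetry. apply Cderiv_C_derive.
  apply (Cderiv_ext_disc (fun w => C_derive_n u 0 w * C_derive_n v 0 w)); auto.
  intros w Hw. symmetry. now apply HF. }
assert (H2 : forall z, unit_disc z -> C_derive_n u 2 z * C_derive_n v 0 z
    + 2 * C_derive_n u 1 z * C_derive_n v 1 z
    + C_derive_n u 0 z * C_derive_n v 2 z = C_derive_n F 2 z).
{ intros z Hz. symmetry. apply Cderiv_C_derive.
  eapply Cderiv_ext_disc; [exact Hz|exact H1|].
  eapply Cderiv_eq; [apply Cderiv_plus; now apply Dm|ring]. }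
assert (H3 : forall z, unit_disc z -> C_derive_n u 3 z * C_derive_n v 0 z
    + 3 * C_derive_n u 2 z * C_derive_n v 1 z + 3 * C_derive_n u 1 z * C_derive_n v 2 z
    + C_derive_n u 0 z * C_derive_n v 3 z = C_derive_n F 3 z).
{ intros z Hz. symmetry. apply Cderiv_C_derive.
  eapply Cderiv_ext_disc; [exact Hz|exact H2|].
  eapply Cderiv_eq.
  - apply Cderiv_plus; [|now apply Dm]. apply Cderiv_plus; [now apply Dm|].
    apply (Cderiv_ext_disc (fun w => 2 * (C_derive_n u 1 w * C_derive_n v 1 w))); auto.
    + intros w _. ring.
    + apply (Cderiv_mult (fun _ => 2)); [apply Cderiv_const|now apply Dm].
  - ring. }
intros z Hz. now rewrite <- H1, <- H2, <- H3.
Qed.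

Lemma Cderiv_sigma (x y : C -> C) (i j : nat) (z : C) : holomorphic x -> holomorphic y ->
  unit_disc z ->
  Cderiv (sigma_ij x y i j) z (sigma_ij x y (S i) j z + sigma_ij x y i (S j) z).
Proof.
intros Hx Hy Hz.
assert (Dx := fun n => holomorphic_Cderiv_n x n Hx z Hz).
assert (Dy := fun n => holomorphic_Cderiv_n y n Hy z Hz).
unfold sigma_ij. eapply Cderiv_eq.
- apply Cderiv_minus; apply Cderiv_mult; auto.
- ring.
Qed.

(** Together with [Cderiv_sigma] this gives [sigma_12' = sigma_13],
    [sigma_13' = sigma_14 + sigma_23] and [(sigma_14 + sigma_23)' = sigma_15 + 2 sigma_24], the
    combinations from which the curvatures are built. *)
Lemma sigma_diag (x y : C -> C) (i : nat) (z : C) : sigma_ij x y i i z = 0.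
Proof. unfold sigma_ij. ring. Qed.

(* Obtained by differentiating [mu ^ 3 * sigma_12 = 1] three times. *)
Lemma normalization_derivatives (x y mu : C -> C) :
  holomorphic x -> holomorphic y -> holomorphic mu ->
  (forall z, unit_disc z -> mu z ^ 3 * sigma_ij x y 1 2 z = 1) ->
  forall z, unit_disc z ->
  let m := fun n => C_derive_n mu n z in
  let s := fun i j => sigma_ij x y i j z in
  3 * m 1%nat * s 1%nat 2%nat + m 0%nat * s 1%nat 3%nat = 0 /\
  3 * m 2%nat * s 1%nat 2%nat + 4 * m 1%nat * s 1%nat 3%nat
    + m 0%nat * (s 1%nat 4%nat + s 2%nat 3%nat) = 0 /\
  3 * m 3%nat * s 1%nat 2%nat + 7 * m 2%nat * s 1%nat 3%nat
    + 5 * m 1%nat * (s 1%nat 4%nat + s 2%nat 3%nat)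
    + m 0%nat * (s 1%nat 5%nat + 2 * s 2%nat 4%nat) = 0.
Proof.
intros Hx Hy Hmu Hn.
assert (Dm := fun n => holomorphic_Cderiv_n mu n Hmu).
assert (Ds := fun i j z => Cderiv_sigma x y i j z Hx Hy).
assert (Dp : forall n i j z, unit_disc z ->
  Cderiv (fun w => C_derive_n mu n w * sigma_ij x y i j w) z
   (C_derive_n mu (S n) z * sigma_ij x y i j z
    + C_derive_n mu n z * (sigma_ij x y (S i) j z + sigma_ij x y i (S j) z)))
  by (intros n i j z Hz; apply Cderiv_mult; auto).
assert (Dc : forall (c z l : C) (f : C -> C), Cderiv f z l -> Cderiv (fun w => c * f w) z (c * l)).
{ intros c z l f Hf. eapply Cderiv_eq.
  - apply Cderiv_mult; [apply Cderiv_const|exact Hf].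
  - cbv beta. ring. }
assert (H1 : forall z, unit_disc z ->
  3 * (C_derive_n mu 1 z * sigma_ij x y 1 2 z) + C_derive_n mu 0 z * sigma_ij x y 1 3 z = 0).
{ intros z Hz. specialize (Hn z Hz) as Hnz.
  assert (Hm0 : mu z <> 0).
  { intros E. apply C1_nz. rewrite <- Hnz, E. ring. }
  (* With the cube grouped this way, the derivative of [mu^3 sigma_12] shows the factor [mu^2],
     which can be cancelled. The remaining relation is linear in [mu] and its derivative, so the
     later differentiations stay linear. *)
  assert (E : mu z * mu z *
    (3 * (C_derive_n mu 1 z * sigma_ij x y 1 2 z) + C_derive_n mu 0 z * sigma_ij x y 1 3 z) = 0).
  { eapply (Cderiv_disc_const (fun w => mu w * mu w * (mu w * sigma_ij x y 1 2 w)) 1); [exact Hz| |].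
    - intros w Hw. rewrite <- (Hn w Hw). ring.
    - eapply Cderiv_eq.
      + apply Cderiv_mult; [apply Cderiv_mult; apply (Dm 0%nat); exact Hz|].
        apply (Dp 0%nat 1%nat 2%nat z Hz).
      + rewrite sigma_diag. cbn [C_derive_n]. ring. }
  destruct (Ceq_dec (3 * (C_derive_n mu 1 z * sigma_ij x y 1 2 z)
    + C_derive_n mu 0 z * sigma_ij x y 1 3 z) 0) as [H|H]; [exact H|].
  destruct (Cmult_neq_0 _ _ (Cmult_neq_0 _ _ Hm0 Hm0) H E). }
assert (H2 : forall z, unit_disc z ->
  3 * (C_derive_n mu 2 z * sigma_ij x y 1 2 z) + 4 * (C_derive_n mu 1 z * sigma_ij x y 1 3 z)
  + (C_derive_n mu 0 z * sigma_ij x y 1 4 z + C_derive_n mu 0 z * sigma_ij x y 2 3 z) = 0).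
{ intros z Hz. apply (Cderiv_disc_const _ 0 z _ Hz H1).
  eapply Cderiv_eq.
  - apply Cderiv_plus; [apply Dc|]; now apply Dp.
  - rewrite sigma_diag. ring. }
assert (H3 : forall z, unit_disc z ->
  3 * (C_derive_n mu 3 z * sigma_ij x y 1 2 z) + 7 * (C_derive_n mu 2 z * sigma_ij x y 1 3 z)
  + 5 * (C_derive_n mu 1 z * (sigma_ij x y 1 4 z + sigma_ij x y 2 3 z))
  + C_derive_n mu 0 z * (sigma_ij x y 1 5 z + 2 * sigma_ij x y 2 4 z) = 0).
{ intros z Hz. apply (Cderiv_disc_const _ 0 z _ Hz H2).
  eapply Cderiv_eq.
  - apply Cderiv_plus; [apply Cderiv_plus; apply Dc; now apply Dp|].
    apply Cderiv_plus; now apply Dp.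
  - rewrite !sigma_diag. ring. }
intros z Hz m s. unfold m, s. repeat split.
- rewrite <- (H1 z Hz). ring.
- rewrite <- (H2 z Hz). ring.
- rewrite <- (H3 z Hz). ring.
Qed.

Lemma C3_neq0 : RtoC 3 <> 0.
Proof. intros E; apply RtoC_inj in E; lra. Qed.

(* The three equations are the coordinates of nu''' = k0 nu + k1 nu' for
   nu = mu (1, x, y). *)
Lemma curvature_equations (m0 m1 m2 m3 x0 x1 x2 x3 y0 y1 y2 y3 k0 k1 : C) :
  let s12 := x1 * y2 - x2 * y1 in
  let s13 := x1 * y3 - x3 * y1 in
  let s23 := x2 * y3 - x3 * y2 in
  m0 <> 0 -> s12 <> 0 -> 3 * m1 * s12 + m0 * s13 = 0 ->
  (m3 = k0 * m0 + k1 * m1 /\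
   m3 * x0 + 3 * m2 * x1 + 3 * m1 * x2 + m0 * x3 = k0 * (m0 * x0) + k1 * (m1 * x0 + m0 * x1) /\
   m3 * y0 + 3 * m2 * y1 + 3 * m1 * y2 + m0 * y3 = k0 * (m0 * y0) + k1 * (m1 * y0 + m0 * y1))
  <->
  (k1 = 3 * m2 / m0 - s23 / s12 /\ k0 = m3 / m0 - k1 * (m1 / m0)).
Proof.
intros s12 s13 s23 Hm Hs HE. split.
- intros (Ha & Hb & Hc). split.
  + assert (E : 3 * m2 * s12 - m0 * s23 = k1 * m0 * s12).
    (* Elimination: [y2] times the second equation minus [x2] times the third removes the terms in
       [m1 x2] and [m1 y2], and a multiple of the first removes [x0] and [y0]. Only [k1]
       survives. *)
    { transitivity (k1 * m0 * s12
        + y2 * ((m3 * x0 + 3 * m2 * x1 + 3 * m1 * x2 + m0 * x3)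
                - (k0 * (m0 * x0) + k1 * (m1 * x0 + m0 * x1)))
        - x2 * ((m3 * y0 + 3 * m2 * y1 + 3 * m1 * y2 + m0 * y3)
                - (k0 * (m0 * y0) + k1 * (m1 * y0 + m0 * y1)))
        - (y2 * x0 - x2 * y0) * (m3 - (k0 * m0 + k1 * m1))).
      - unfold s12, s23. ring.
      - rewrite Hb, Hc, Ha. ring. }
    transitivity (k1 * m0 * s12 / (m0 * s12)); [field; auto|rewrite <- E; field; auto].
  + rewrite Ha. field. exact Hm.
- intros (H1 & H0).
  assert (Ha : m3 = k0 * m0 + k1 * m1) by (rewrite H0; field; exact Hm).
  (* Up to the factor [m0^2], [HE] says that the determinant of [nu, nu', nu'''] vanishes: it is the
     compatibility condition of three equations in two unknowns. *)
  assert (Hm1 : m1 = - (m0 * s13) / (3 * s12)).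
  { transitivity ((3 * m1 * s12 + m0 * s13 - m0 * s13) / (3 * s12));
      [field; auto|rewrite HE; field; auto]. }
  (* The second and third equations are treated at once, with [u] standing for [x] or [y]. The
     condition on [u] is the expansion of a determinant with rows [u], [x], [y], zero because a row
     is repeated. *)
  assert (Haux : forall u0 u1 u2 u3 : C, u1 * s23 - u2 * s13 + u3 * s12 = 0 ->
    m3 * u0 + 3 * m2 * u1 + 3 * m1 * u2 + m0 * u3 = k0 * (m0 * u0) + k1 * (m1 * u0 + m0 * u1)).
  { intros u0 u1 u2 u3 Hu.
    transitivity ((k0 * m0 + k1 * m1) * u0 + 3 * m2 * u1 + 3 * m1 * u2 + m0 * u3);
      [now rewrite <- Ha|].
    apply Ceq_minus.
    transitivity (m0 / s12 * (u1 * s23 - u2 * s13 + u3 * s12)); [|rewrite Hu; ring].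
    transitivity (3 * m2 * u1 + 3 * m1 * u2 + m0 * u3 - k1 * m0 * u1); [ring|].
    rewrite H1. clearbody s12 s13 s23.
    transitivity (3 * m1 * u2 + m0 * u3 + m0 * u1 * s23 / s12); [field; auto|].
    rewrite Hm1. field. auto. }
  split; [exact Ha|]. split; apply Haux; unfold s12, s13, s23; ring.
Qed.

(** The normalization relations are triangular, so they give [m1], [m2], [m3] in turn as multiples
    of [m0]. The curvatures involve only the quotients by [m0], from which [m0] disappears. *)
Lemma curvature_formulas (m0 m1 m2 m3 s12 s13 s14 s15 s23 s24 k0 k1 : C) :
  m0 <> 0 -> s12 <> 0 ->
  3 * m1 * s12 + m0 * s13 = 0 ->
  3 * m2 * s12 + 4 * m1 * s13 + m0 * (s14 + s23) = 0 ->
  3 * m3 * s12 + 7 * m2 * s13 + 5 * m1 * (s14 + s23) + m0 * (s15 + 2 * s24) = 0 ->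
  (k1 = 3 * m2 / m0 - s23 / s12 /\ k0 = m3 / m0 - k1 * (m1 / m0)) <->
  (k0 = - (16 / 27) * (s13 / s12) ^ 3 + 1 / 3 * (s13 * (3 * s14 + 2 * s23) / s12 ^ 2)
        - 1 / 3 * ((s15 + 2 * s24) / s12) /\
   k1 = 4 / 3 * (s13 / s12) ^ 2 - (s14 + 2 * s23) / s12).
Proof.
intros Hm Hs E1 E2 E3. assert (H3 := C3_neq0).
assert (H27 : RtoC 27 <> 0) by (intros E; apply RtoC_inj in E; lra).
assert (Hdiv : forall a b : C, 3 * a * s12 + b = 0 -> a = - b / (3 * s12)).
{ intros a b E. transitivity ((3 * a * s12 + b - b) / (3 * s12)); [|rewrite E]; field; auto. }
assert (M1 : m1 = m0 * (- s13 / (3 * s12))).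
{ rewrite (Hdiv _ _ E1). field. auto. }
assert (M2 : m2 = m0 * ((4 * s13 ^ 2 / (3 * s12) - (s14 + s23)) / (3 * s12))).
{ rewrite (Hdiv m2 (4 * m1 * s13 + m0 * (s14 + s23))), M1 by (rewrite <- E2; ring). field. auto. }
assert (M3 : m3 = m0 * ((- 7 * s13 * ((4 * s13 ^ 2 / (3 * s12) - (s14 + s23)) / (3 * s12))
   + 5 * s13 / (3 * s12) * (s14 + s23) - (s15 + 2 * s24)) / (3 * s12))).
{ rewrite (Hdiv m3 (7 * m2 * s13 + 5 * m1 * (s14 + s23) + m0 * (s15 + 2 * s24))), M1, M2
    by (rewrite <- E3; ring). field. auto. }
assert (K1 : 3 * m2 / m0 - s23 / s12 = 4 / 3 * (s13 / s12) ^ 2 - (s14 + 2 * s23) / s12).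
{ rewrite M2. field. auto. }
assert (K0 : m3 / m0 - (4 / 3 * (s13 / s12) ^ 2 - (s14 + 2 * s23) / s12) * (m1 / m0) =
  - (16 / 27) * (s13 / s12) ^ 3 + 1 / 3 * (s13 * (3 * s14 + 2 * s23) / s12 ^ 2)
        - 1 / 3 * ((s15 + 2 * s24) / s12)).
{ rewrite M3, M1. field. auto. }
rewrite K1, <- K0. split; intros [Ha Hb]; split; try assumption.
- now rewrite Hb, Ha.
- now rewrite Ha, Hb.
Qed.

(** * Liftings in three-dimensional space *)

Lemma is_derive_proj {U V : NormedModule C_AbsRing} (f : C -> prod_NormedModule C_AbsRing U V)
  (z : C) : ex_derive f z ->
  ex_derive (fun w => fst (f w)) z /\ ex_derive (fun w => snd (f w)) z.
Proof.
intros [l H]. split.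
- exists (fst l).
  apply (filterdiff_comp' (U := AbsRing_NormedModule C_AbsRing) f (fun p => fst p) z (fun y => scal y l) (fun p => fst p) H).
  apply filterdiff_linear, is_linear_fst.
- exists (snd l).
  apply (filterdiff_comp' (U := AbsRing_NormedModule C_AbsRing) f (fun p => snd p) z (fun y => scal y l) (fun p => snd p) H).
  apply filterdiff_linear, is_linear_snd.
Qed.

Lemma ex_derive_pair {U V : NormedModule C_AbsRing} (f : C -> U) (g : C -> V) (z : C) :
  ex_derive f z -> ex_derive g z ->
  ex_derive (V := prod_NormedModule C_AbsRing U V) (fun w => (f w, g w)) z.
Proof.
intros [a Ha] [b Hb]. exists (a, b).
apply (filterdiff_comp'_2 (T := AbsRing_NormedModule C_AbsRing) f g (fun u v => (u, v)) z (fun y => scal y a) (fun y => scal y b)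
  (fun u v => (u, v)) Ha Hb).
apply filterdiff_linear.
apply is_linear_prod; [apply is_linear_fst|apply is_linear_snd].
Qed.

(** The common shape of every lifting of the affine curve and of its scalar multiples, so that one
    computation serves [f] and [nu] alike. *)
Definition affine_multiple (x y mu : C -> C) (nu : C -> C3) : Prop :=
  forall z, unit_disc z -> nu z = vec3 (mu z) (mu z * x z) (mu z * y z).

Lemma affine_multiple_derivatives (x y mu : C -> C) (nu : C -> C3) :
  holomorphic x -> holomorphic y -> holomorphic mu -> affine_multiple x y mu nu ->
  forall z, unit_disc z ->
  let m := fun n => C_derive_n mu n z in
  let x := fun n => C_derive_n x n z in
  let y := fun n => C_derive_n y n z in
  C3_derive_n nu 1 z = vec3 (m 1%nat)
    (m 1%nat * x 0%nat + m 0%nat * x 1%nat) (m 1%nat * y 0%nat + m 0%nat * y 1%nat) /\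
  C3_derive_n nu 2 z = vec3 (m 2%nat)
    (m 2%nat * x 0%nat + 2 * m 1%nat * x 1%nat + m 0%nat * x 2%nat)
    (m 2%nat * y 0%nat + 2 * m 1%nat * y 1%nat + m 0%nat * y 2%nat) /\
  C3_derive_n nu 3 z = vec3 (m 3%nat)
    (m 3%nat * x 0%nat + 3 * m 2%nat * x 1%nat + 3 * m 1%nat * x 2%nat + m 0%nat * x 3%nat)
    (m 3%nat * y 0%nat + 3 * m 2%nat * y 1%nat + 3 * m 1%nat * y 2%nat + m 0%nat * y 3%nat).
Proof.
intros Hx Hy Hmu Hnu z Hz m x' y'.
assert (A : forall n, C_derive_n (fun w => fst (fst (nu w))) n z = C_derive_n mu n z).
{ intros n. symmetry. apply C_derive_n_ext_disc; auto. intros w Hw. now rewrite (Hnu w Hw). }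
destruct (C_derive_n_mult (fun w => snd (fst (nu w))) mu x Hmu Hx) with (z := z)
  as (B1 & B2 & B3); auto.
{ intros w Hw. now rewrite (Hnu w Hw). }
destruct (C_derive_n_mult (fun w => snd (nu w)) mu y Hmu Hy) with (z := z)
  as (D1 & D2 & D3); auto.
{ intros w Hw. now rewrite (Hnu w Hw). }
unfold C3_derive_n.
rewrite !A, B1, B2, B3, D1, D2, D3. repeat split.
Qed.

Lemma affine_multiple_det (x y mu : C -> C) (nu : C -> C3) :
  holomorphic x -> holomorphic y -> holomorphic mu -> affine_multiple x y mu nu ->
  forall z, unit_disc z ->
  det3 (nu z) (C3_derive_n nu 1 z) (C3_derive_n nu 2 z) = mu z ^ 3 * sigma_ij x y 1 2 z.
Proof.
intros Hx Hy Hmu Hnu z Hz.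
destruct (affine_multiple_derivatives x y mu nu Hx Hy Hmu Hnu z Hz) as (H1 & H2 & _).
rewrite H1, H2, (Hnu z Hz). unfold vec3, det3, sigma_ij. simpl (C_derive_n _ 0 z). ring.
Qed.

(** Cramer's rule: combining the coordinates of the relation with the cofactors of one vector leaves
    the coefficient of that vector times the determinant. *)
Lemma det3_lin_indep3 (u v w : C3) : det3 u v w <> 0 -> lin_indep3 u v w.
Proof.
destruct u as [[u1 u2] u3], v as [[v1 v2] v3], w as [[w1 w2] w3]. unfold det3.
intros Hd a b c H.
set (d := u1 * (v2 * w3 - v3 * w2) - u2 * (v1 * w3 - v3 * w1) + u3 * (v1 * w2 - v2 * w1)) in *.
change ((a * u1 + b * v1 + c * w1, a * u2 + b * v2 + c * w2, a * u3 + b * v3 + c * w3)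
  = (RtoC 0, RtoC 0, RtoC 0)) in H.
assert (H1 := f_equal (fun p => fst (fst p)) H).
assert (H2 := f_equal (fun p => snd (fst p)) H).
assert (H3 := f_equal (fun p => snd p) H). cbv beta in H1, H2, H3. cbn [fst snd] in H1, H2, H3.
assert (Hz : forall t, t * d = 0 -> t = 0).
{ intros t E. destruct (Ceq_dec t 0) as [H0|H0]; [exact H0|].
  destruct (Cmult_neq_0 _ _ H0 Hd E). }
repeat split; apply Hz.
- transitivity ((a * u1 + b * v1 + c * w1) * (v2 * w3 - v3 * w2)
    - (a * u2 + b * v2 + c * w2) * (v1 * w3 - v3 * w1)
    + (a * u3 + b * v3 + c * w3) * (v1 * w2 - v2 * w1)); [unfold d; ring|].
  rewrite H1, H2, H3. ring.
- transitivity (- ((a * u1 + b * v1 + c * w1) * (u2 * w3 - u3 * w2)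
    - (a * u2 + b * v2 + c * w2) * (u1 * w3 - u3 * w1)
    + (a * u3 + b * v3 + c * w3) * (u1 * w2 - u2 * w1))); [unfold d; ring|].
  rewrite H1, H2, H3. ring.
- transitivity ((a * u1 + b * v1 + c * w1) * (u2 * v3 - u3 * v2)
    - (a * u2 + b * v2 + c * w2) * (u1 * v3 - u3 * v1)
    + (a * u3 + b * v3 + c * w3) * (u1 * v2 - u2 * v1)); [unfold d; ring|].
  rewrite H1, H2, H3. ring.
Qed.

(** An equivalence for two numbers at one point, and for any [mu] satisfying the normalization. It
    thus yields the formulas from a given lifting and verifies the equation for a constructed
    one. *)
Lemma normalized_lifting_curvatures (x y mu : C -> C) (nu : C -> C3) :
  holomorphic x -> holomorphic y -> holomorphic mu -> affine_multiple x y mu nu ->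
  (forall z, unit_disc z -> mu z ^ 3 * sigma_ij x y 1 2 z = 1) ->
  forall z k0 k1, unit_disc z ->
  let s := fun i j => sigma_ij x y i j z in
  C3_derive_n nu 3 z = plus (scal k0 (nu z)) (scal k1 (C3_derive_n nu 1 z)) <->
  (k0 = - (16 / 27) * (s 1%nat 3%nat / s 1%nat 2%nat) ^ 3
        + 1 / 3 * (s 1%nat 3%nat * (3 * s 1%nat 4%nat + 2 * s 2%nat 3%nat) / s 1%nat 2%nat ^ 2)
        - 1 / 3 * ((s 1%nat 5%nat + 2 * s 2%nat 4%nat) / s 1%nat 2%nat) /\
   k1 = 4 / 3 * (s 1%nat 3%nat / s 1%nat 2%nat) ^ 2
        - (s 1%nat 4%nat + 2 * s 2%nat 3%nat) / s 1%nat 2%nat).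
Proof.
intros Hx Hy Hmu Hnu Hn z k0 k1 Hz s.
destruct (affine_multiple_derivatives x y mu nu Hx Hy Hmu Hnu z Hz) as (H1 & _ & H3).
destruct (normalization_derivatives x y mu Hx Hy Hmu Hn z Hz) as (E1 & E2 & E3).
specialize (Hn z Hz).
assert (Hm0 : mu z <> 0) by (intros E; apply C1_nz; rewrite <- Hn, E; ring).
assert (Hs : s 1%nat 2%nat <> 0) by (unfold s; intros E; apply C1_nz; rewrite <- Hn, E; ring).
refine (iff_trans _ (curvature_formulas _ _ _ _ _ _ _ _ _ _ k0 k1 Hm0 Hs E1 E2 E3)).
refine (iff_trans _ (curvature_equations _ _ _ (C_derive_n mu 3 z) (x z) _ _ _ (y z) _ _ _
  k0 k1 Hm0 Hs E1)).
rewrite H1, H3, (Hnu z Hz).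
match goal with |- vec3 ?a ?b ?c = _ <-> _ =>
  change (vec3 a b c = vec3 (k0 * mu z + k1 * C_derive_n mu 1 z)
    (k0 * (mu z * x z) + k1 * (C_derive_n mu 1 z * x z + mu z * C_derive_n x 1 z))
    (k0 * (mu z * y z) + k1 * (C_derive_n mu 1 z * y z + mu z * C_derive_n y 1 z)) <->
    (a = (k0 * mu z + k1 * C_derive_n mu 1 z) /\
     b = (k0 * (mu z * x z) + k1 * (C_derive_n mu 1 z * x z + mu z * C_derive_n x 1 z)) /\
     c = (k0 * (mu z * y z) + k1 * (C_derive_n mu 1 z * y z + mu z * C_derive_n y 1 z)))) end.
split.
- intros H. split; [exact (f_equal (fun p => fst (fst p)) H)|].
  split; [exact (f_equal (fun p => snd (fst p)) H)|exact (f_equal (fun p => snd p) H)].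
- now intros (-> & -> & ->).
Qed.

Lemma holomorphic_first_coordinate (f : C -> C3) : holomorphic f ->
  holomorphic (fun z => fst (fst (f z))).
Proof.
intros Hf z Hz.
destruct (is_derive_proj f z (Hf z Hz)) as [H _].
exact (proj1 (is_derive_proj (fun w => fst (f w)) z H)).
Qed.

Lemma holomorphic_mult (f g : C -> C) : holomorphic f -> holomorphic g ->
  holomorphic (fun z => f z * g z).
Proof.
intros Hf Hg z Hz. eapply Cderiv_ex_derive, Cderiv_mult.
- exact (holomorphic_Cderiv f z (Hf z Hz)).
- exact (holomorphic_Cderiv g z (Hg z Hz)).
Qed.

Theorem mainTheorem5 :
  forall x y : C -> C,
  holomorphic x -> holomorphic y ->
  (forall z : C, unit_disc z -> sigma_ij x y 1 2 z <> 0) ->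
  forall kappa0 kappa1 : C -> C,
  (schwarzian_curvatures (affine_curve x y) kappa0 kappa1 <->
   forall z : C, unit_disc z ->
     kappa0 z =
       - (16 / 27) * (sigma_ij x y 1 3 z / sigma_ij x y 1 2 z) ^ 3
       + 1 / 3 * (sigma_ij x y 1 3 z * (3 * sigma_ij x y 1 4 z + 2 * sigma_ij x y 2 3 z)
                  / sigma_ij x y 1 2 z ^ 2)
       - 1 / 3 * ((sigma_ij x y 1 5 z + 2 * sigma_ij x y 2 4 z) / sigma_ij x y 1 2 z)
     /\
     kappa1 z =
       4 / 3 * (sigma_ij x y 1 3 z / sigma_ij x y 1 2 z) ^ 2
       - (sigma_ij x y 1 4 z + 2 * sigma_ij x y 2 3 z) / sigma_ij x y 1 2 z).
Proof.
intros x y Hx Hy Hs k0 k1. split.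
- intros (_ & _ & f & lam & [Hf Hrep] & _ & Hlam & _ & Hdet & Hode) z Hz.
  (* The class of [f w] is that of [(1, x w, y w)], so the unknown proportionality factor can be
     read off as the first coordinate, which makes it holomorphic. *)
  set (c := fun w => fst (fst (f w))).
  assert (Hc : holomorphic c) by now apply holomorphic_first_coordinate.
  assert (Hfc : affine_multiple x y c f).
  { intros w Hw. destruct (Hrep w Hw) as (a & _ & Ha).
    change (f w = vec3 (a * 1) (a * x w) (a * y w)) in Ha.
    assert (Hca : c w = a) by (unfold c; rewrite Ha; simpl; ring).
    rewrite Hca, Ha. f_equal. ring. }
  apply (normalized_lifting_curvatures x y (fun w => lam w * c w)
    (fun w => scal (lam w) (f w)) Hx Hy (holomorphic_mult lam c Hlam Hc)); auto.
  + intros w Hw. rewrite (Hfc w Hw).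
    change (vec3 (lam w * c w) (lam w * (c w * x w)) (lam w * (c w * y w)) =
      vec3 (lam w * c w) (lam w * c w * x w) (lam w * c w * y w)).
    now rewrite !Cmult_assoc.
  (* [det3] of [f] and its two derivatives is [c^3 sigma_12], so the given normalization is the one
     for [lam * c]. *)
  + intros w Hw. rewrite <- (Hdet w Hw), (affine_multiple_det x y c f) by auto. ring.
- intros Hk.
  assert (Ds := fun i j w => Cderiv_sigma x y i j w Hx Hy).
  destruct (disc_inv_cube_root (sigma_ij x y 1 2) _ (fun w Hw => Ds 1%nat 2%nat w Hw) Hs)
    as (lam & Hlam & Hlam0 & Hn).
  assert (H1 : holomorphic (fun _ : C => RtoC 1)).
  { intros w _. exact (Cderiv_ex_derive _ _ _ (Cderiv_const 1 w)). }
  assert (Hdiv : forall (g : C -> C), holomorphic g ->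
    holomorphic (fun z => g z / sigma_ij x y 1 2 z)).
  { intros g Hg. apply holomorphic_mult; [exact Hg|].
    intros z Hz. eapply Cderiv_ex_derive.
    apply (Cderiv_comp Cinv); [apply Cderiv_inv; auto|now apply Ds]. }
  assert (Hsig : forall i j, holomorphic (sigma_ij x y i j)).
  { intros i j z Hz. exact (Cderiv_ex_derive _ _ _ (Ds i j z Hz)). }
  assert (Hplus : forall f g : C -> C, holomorphic f -> holomorphic g ->
    holomorphic (fun z => f z + g z)).
  { intros f g Hf Hg z Hz. eapply Cderiv_ex_derive, Cderiv_plus.
    - exact (holomorphic_Cderiv f z (Hf z Hz)).
    - exact (holomorphic_Cderiv g z (Hg z Hz)). }
  assert (Hscal : forall (c : C) (g : C -> C), holomorphic g -> holomorphic (fun z => c * g z)).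
  { intros c g Hg. apply (holomorphic_mult (fun _ => c)); [|exact Hg].
    intros w _. exact (Cderiv_ex_derive _ _ _ (Cderiv_const c w)). }
  (* The prescribed curvatures are total functions that match the formulas only on the disc, so
     holomorphy has to be transported along equality there. *)
  assert (Hext : forall f g : C -> C, (forall z, unit_disc z -> f z = g z) ->
    holomorphic f -> holomorphic g).
  { intros f g Hfg Hf z Hz. eapply Cderiv_ex_derive, (Cderiv_ext_disc f g); auto.
    exact (holomorphic_Cderiv f z (Hf z Hz)). }
  set (A := fun z => sigma_ij x y 1 3 z / sigma_ij x y 1 2 z).
  assert (HA : holomorphic A) by now apply Hdiv.
  split; [|split].
  (* The formula is rewritten with sums, products and single divisions by [sigma_12], so that the
     closure properties above apply directly. *)
  + apply (Hext (fun z => - (16 / 27) * (A z * (A z * A z))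
       + (1 / 3 * (A z * ((3 * sigma_ij x y 1 4 z + 2 * sigma_ij x y 2 3 z) / sigma_ij x y 1 2 z))
       + - (1 / 3) * ((sigma_ij x y 1 5 z + 2 * sigma_ij x y 2 4 z) / sigma_ij x y 1 2 z)))).
    * intros z Hz. rewrite (proj1 (Hk z Hz)). unfold A. field. auto.
    * apply Hplus; [|apply Hplus]; apply Hscal;
        repeat (apply holomorphic_mult; [exact HA|]); try exact HA; apply Hdiv;
        apply Hplus; auto.
  + apply (Hext (fun z => 4 / 3 * (A z * A z)
       + -(1) * ((sigma_ij x y 1 4 z + 2 * sigma_ij x y 2 3 z) / sigma_ij x y 1 2 z))).
    * intros z Hz. rewrite (proj2 (Hk z Hz)). unfold A. field. auto.
    * apply Hplus; apply Hscal; [now apply holomorphic_mult|]. apply Hdiv, Hplus; auto.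
  (* The lifting with first coordinate 1 has determinant [sigma_12], so the inverse cube root [lam]
     normalizes it and is itself the [mu] of the computation. *)
  + set (f := fun z => vec3 1 (x z) (y z)).
    assert (Hf : affine_multiple x y (fun _ => 1) f).
    { intros w _. unfold f. now rewrite !Cmult_1_l. }
    assert (Hdet := affine_multiple_det x y _ f Hx Hy H1 Hf).
    exists f, lam. split; [split|split; [|split; [|split; [|split]]]].
    * intros z Hz. apply (ex_derive_pair (fun w => (RtoC 1, x w)) y); [|now apply Hy].
      apply (ex_derive_pair (fun _ => RtoC 1) x); [now apply H1|now apply Hx].
    * intros z Hz. exists 1. split; [exact C1_nz|].
      change (vec3 1 (x z) (y z) = vec3 (1 * 1) (1 * x z) (1 * y z)).
      now rewrite !Cmult_1_l.
    * intros z Hz. apply det3_lin_indep3. rewrite (Hdet z Hz).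
      replace (1 ^ 3 * sigma_ij x y 1 2 z) with (sigma_ij x y 1 2 z) by ring. now apply Hs.
    * exact Hlam.
    * exact Hlam0.
    * intros z Hz. rewrite (Hdet z Hz).
      transitivity (lam z ^ 3 * sigma_ij x y 1 2 z); [ring|now apply Hn].
    * intros nu z Hz.
      apply (normalized_lifting_curvatures x y lam nu Hx Hy Hlam); auto.
      intros w Hw.
      change (vec3 (lam w * 1) (lam w * x w) (lam w * y w) =
        vec3 (lam w) (lam w * x w) (lam w * y w)).
      now rewrite Cmult_1_r.
Qed.
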